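(* Let $\Lambda$ be a nonincreasing and positive function on $]0,2]$ such that $\Lambda(0^+)=+\infty$, and let $I$ be the singular inner function $I(z)=e^{-\frac{1+z}{1-z}}$, $z\in\mathbb{D}$. Then $I$ is cyclic in $\mathcal{B}^\infty_{\Lambda,\{1\}}$ if and only if $$\int_0^2\Lambda(t)\,dt=\infty.$$
   Context: $\mathbb{D}$ is the open unit disk in $\mathbb{C}$. $\mathcal{B}^\infty_{\Lambda,\{1\}}$ is the space of all analytic functions $f$ on $\mathbb{D}$ such that $$\|f\|_{\Lambda,\{1\},\infty}=\sup_{z\in\mathbb{D}}|f(z)|\,e^{-\Lambda(|1-z|)}<\infty.$$ A function $f$ in the space is said to be cyclic in it if the set of functions $pf$ with $p$ a polynomial is dense in the space.
   Formalization: Cyclic is taken to mean that I lies in, and its polynomial multiples are norm-dense in, the norm closure of the polynomials in the space; in the full space of all analytic f with finite norm the multiples of I are never dense, since exp(-(1-z)/(1+z)) has no limit at -1. *)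

(* Defs.v *)
(* MathComp-Analysis; complex numbers are R[i] (mathcomp-real-closed), R : realType *)
From HB Require Import structures.
From mathcomp Require Import all_boot all_order all_algebra.
From mathcomp Require Import all_classical all_reals all_analysis.
From mathcomp Require Import complex.

Set Implicit Arguments.
Unset Strict Implicit.
Unset Printing Implicit Defensive.

Import Order.TTheory GRing.Theory Num.Theory numFieldNormedType.Exports.

Local Open Scope classical_set_scope.
Local Open Scope ring_scope.

Definition cmod (R : realType) (z : R[i]) : R := ComplexField.Normc.normc z.

Definition unit_disk (R : realType) : set R[i] := [set z | cmod z < 1].

Definition cexp (R : realType) (z : R[i]) : R[i] :=
  Complex (expR (complex.Re z) * cos (complex.Im z))
          (expR (complex.Re z) * sin (complex.Im z)).

(* Functions on the disk are represented by total functions; every notion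
   below only looks at their values on the open unit disk. *)
Definition disk_analytic (R : realType) (f : R[i] -> R[i]) : Prop :=
  forall z : R[i], unit_disk z -> derivable (f : R[i]^o -> R[i]^o) z 1.

Definition weighted_norm (R : realType) (Lambda : R -> R) (f : R[i] -> R[i]) :
    \bar R :=
  ereal_sup [set (cmod (f z) * expR (- Lambda (cmod (1 - z))))%:E
            | z in @unit_disk R].

Definition weighted_space (R : realType) (Lambda : R -> R) :
    set (R[i] -> R[i]) :=
  [set f | disk_analytic f /\ (weighted_norm Lambda f < +oo)%E].

(* g is in the closure, for the norm, of the set of polynomial multiples of f *)
Definition in_closure_multiples (R : realType) (Lambda : R -> R)
    (f g : R[i] -> R[i]) : Prop :=
  forall eps : R, 0 < eps -> exists p : {poly R[i]},
    (weighted_norm Lambda (fun z => (p.[z] * f z - g z)%R) < eps%:E)%E.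

(* Cyclicity presupposes a space in which the polynomials are dense.  The full
   weighted space is not of this kind: norm limits of polynomials extend
   continuously to the closed disk minus {1}, while for instance
   exp (- (1 - z) / (1 + z)) is bounded by 1 but has no limit at -1, so that no
   function at all which is continuous off 1 would have norm-dense polynomial
   multiples.  The ambient space of the definition of cyclicity is therefore
   the norm closure of the polynomials in the weighted space. *)
Definition polynomial_closure (R : realType) (Lambda : R -> R) :
    set (R[i] -> R[i]) :=
  [set g | weighted_space Lambda g /\
           in_closure_multiples Lambda (fun=> 1) g].

Definition cyclic_in_weighted_space (R : realType) (Lambda : R -> R)
    (f : R[i] -> R[i]) : Prop :=
  polynomial_closure Lambda f /\
  forall g, polynomial_closure Lambda g -> in_closure_multiples Lambda f g.

Definition inner_I (R : realType) (z : R[i]) : R[i] :=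
  cexp (- ((1 + z) / (1 - z))).

(* Main.v *)
Require Import Defs.
From HB Require Import structures.
From mathcomp Require Import all_boot all_order all_algebra.
From mathcomp Require Import all_classical all_reals all_analysis.
From mathcomp Require Import complex measurable_realfun.
From mathcomp Require Import ring lra.
Import Order.TTheory GRing.Theory Num.Theory numFieldNormedType.Exports.
Local Open Scope classical_set_scope.
Local Open Scope ring_scope.

Set Implicit Arguments.
Unset Strict Implicit.
Unset Printing Implicit Defensive.

(** Put v = 2 / (1 - z).  It maps the disk onto the half-plane Re v > 1, where
    |1 - z| = 2 / |v| and I(z) = exp (1 - v).  With M(r) = Lambda(2 / r), the
    condition on Lambda is the divergence of the integral of M(r) / r ^ 2 at
    infinity, the logarithmic integral that decides whether a function of size
    exp M on the boundary can grow like exp Re v inside.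

    Multiplying an approximation of 1 by a polynomial is harmless, so that I is
    cyclic exactly when p I is close to 1 for some polynomials p
    ([cyclic_inner_I]).  By monotonicity of Lambda, the integral diverges exactly
    when the series of Lambda(2 ^ -k) 2 ^ -k does ([integral_infty_dyadic]).

    If the series converges ([summable_not_in_closure]): when I is cyclic, so is
    each I ^ n, and then |p I ^ n - 1| <= exp Lambda / C for some p.  Hence
    log |p| <= n (Re v - 1) + M(|v|) + log 2.  The sum of
    Lambda(2 ^ -k) 2 v / (v + 2 ^ k) over finitely many k has a real part that
    dominates M or, very close to 1, the logarithm of a bound for p; its value at
    z = 0 is bounded in terms of the sum of the series.  The maximum principle,
    applied on a circle so close to the unit circle that n (Re v - 1) is at
    most 1 off a neighbourhood of 1, bounds |p(0)| independently of n, which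
    contradicts I(0) ^ n -> 0.

    If it diverges ([divergent_in_closure]): it suffices to find h with
    |exp (h - v) - 1| small compared to exp M(|v|), since exp (h - 1) I is
    exp (h - v).  Take for h a sum of Poisson kernels of the half-plane at the
    points i j and - i j, N <= j < N', with weights m_j bounded
    both by a small multiple of M(j / 2) - A and by delta j.  For |v| much
    smaller than N, h is nearly v times the sum of 2 m_j / j ^ 2, and divergence
    allows that sum to be brought to 1 - 5 delta however large N is
    ([pole_weights]), so that h - v is small.  Everywhere else Re h - Re v is at most M(|v|) - A
    ([poisson_sum_bound]): the poles at distance O(|v|) contribute at most that,
    and the others at most Re v.  Points on the imaginary axis, and not poles on
    the negative half-line as in the first part, are needed because M may jump:
    the kernel of a far pole must be O(Re v), not just small.

    The function to which the maximum principle is applied is a uniform limit of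
    polynomials on the disk, so that the principle is only needed for
    polynomials, at the centre, where it is elementary ([horner0_circle]). *)

(** * The modulus and the exponential of complex numbers *)

Lemma cmodE (R : realType) (z : R[i]) :
  cmod z = Num.sqrt (complex.Re z ^+ 2 + complex.Im z ^+ 2).
Proof. by case: z. Qed.

Lemma sqr_cmod (R : realType) (z : R[i]) :
  cmod z ^+ 2 = complex.Re z ^+ 2 + complex.Im z ^+ 2.
Proof. by rewrite cmodE sqr_sqrtr// addr_ge0 ?sqr_ge0. Qed.

Lemma cmod_ge0 (R : realType) (z : R[i]) : 0 <= cmod z.
Proof. by rewrite cmodE sqrtr_ge0. Qed.

Lemma cmod0 (R : realType) : cmod (0 : R[i]) = 0.
Proof. exact: ComplexField.Normc.normc0. Qed.

Lemma cmod1 (R : realType) : cmod (1 : R[i]) = 1.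
Proof. exact: ComplexField.Normc.normc1. Qed.

Lemma cmod_eq0 (R : realType) (z : R[i]) : (cmod z == 0) = (z == 0).
Proof.
apply/eqP/eqP => [|->]; last exact: cmod0.
exact: ComplexField.Normc.eq0_normc.
Qed.

Lemma cmod_gt0 (R : realType) (z : R[i]) : (0 < cmod z) = (z != 0).
Proof. by rewrite lt_def cmod_ge0 cmod_eq0 andbT. Qed.

Lemma cmodM (R : realType) (x y : R[i]) : cmod (x * y) = cmod x * cmod y.
Proof. exact: ComplexField.Normc.normcM. Qed.

Lemma cmodV (R : realType) (x : R[i]) : cmod x^-1 = (cmod x)^-1.
Proof. exact: ComplexField.Normc.normcV. Qed.

Lemma cmodX (R : realType) (x : R[i]) n : cmod (x ^+ n) = cmod x ^+ n.
Proof.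
by elim: n => [|n IHn]; rewrite ?expr0 ?cmod1// !exprS cmodM IHn.
Qed.

Lemma cmodN (R : realType) (x : R[i]) : cmod (- x) = cmod x.
Proof. exact: normcN. Qed.

Lemma cmodB (R : realType) (x y : R[i]) : cmod (x - y) = cmod (y - x).
Proof. by rewrite -cmodN opprB. Qed.

Lemma le_cmodD (R : realType) (x y : R[i]) : cmod (x + y) <= cmod x + cmod y.
Proof. exact: le_normcD. Qed.

Lemma le_cmodB (R : realType) (x y : R[i]) : cmod (x - y) <= cmod x + cmod y.
Proof. by rewrite (le_trans (le_cmodD _ _))// cmodN. Qed.

Lemma le_cmod_dist (R : realType) (y x z : R[i]) :
  cmod (x - z) <= cmod (x - y) + cmod (y - z).
Proof.
have -> : x - z = (x - y) + (y - z) by rewrite addrA subrK.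
exact: le_cmodD.
Qed.

Lemma ler_cmodB (R : realType) (x y : R[i]) : cmod x - cmod y <= cmod (x - y).
Proof.
have := le_cmodD (x - y) y; rewrite subrK; lra.
Qed.

Lemma le_cmod_sum (R : realType) (I : Type) (s : seq I) (P : pred I)
    (F : I -> R[i]) :
  cmod (\sum_(i <- s | P i) F i) <= \sum_(i <- s | P i) cmod (F i).
Proof.
apply: (big_ind2 (fun x y => cmod x <= y)) => //; first by rewrite cmod0.
by move=> x1 x2 y1 y2 le1 le2; rewrite (le_trans (le_cmodD _ _))// lerD.
Qed.

Lemma cmod_real (R : realType) (a : R) : cmod (a%:C)%C = `|a|.
Proof. by rewrite /cmod /= expr0n/= addr0 sqrtr_sqr. Qed.

Lemma cmod_nat (R : realType) n : cmod (n%:R : R[i]) = n%:R.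
Proof.
by rewrite -(rmorph_nat (real_complex R)) cmod_real normr_nat.
Qed.

Lemma ger_Re_cmod (R : realType) (z : R[i]) : `|complex.Re z| <= cmod z.
Proof. by rewrite cmodE -sqrtr_sqr ler_wsqrtr// lerDl sqr_ge0. Qed.

Lemma ger_Im_cmod (R : realType) (z : R[i]) : `|complex.Im z| <= cmod z.
Proof. by rewrite cmodE -sqrtr_sqr ler_wsqrtr// lerDr sqr_ge0. Qed.

Lemma cmod_le_ReIm (R : realType) (z : R[i]) :
  cmod z <= `|complex.Re z| + `|complex.Im z|.
Proof.
rewrite -(@ler_pXn2r _ 2)// ?nnegrE ?cmod_ge0 ?addr_ge0//.
rewrite sqr_cmod sqrrD !real_normK ?num_real//.
have : 0 <= `|complex.Re z| * `|complex.Im z| by rewrite mulr_ge0.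
lra.
Qed.

Lemma ReD (R : realType) (x y : R[i]) :
  complex.Re (x + y) = complex.Re x + complex.Re y.
Proof. by case: x y => [a b] [c d]. Qed.

Lemma ReN (R : realType) (x : R[i]) : complex.Re (- x) = - complex.Re x.
Proof. by case: x. Qed.

Lemma ImD (R : realType) (x y : R[i]) :
  complex.Im (x + y) = complex.Im x + complex.Im y.
Proof. by case: x y => [a b] [c d]. Qed.

Lemma ImN (R : realType) (x : R[i]) : complex.Im (- x) = - complex.Im x.
Proof. by case: x. Qed.

Lemma Re_sum (R : realType) (I : Type) (s : seq I) (P : pred I)
    (F : I -> R[i]) :
  complex.Re (\sum_(i <- s | P i) F i) = \sum_(i <- s | P i) complex.Re (F i).
Proof.
apply: (big_ind2 (fun x y => complex.Re x = y)) => // x1 x2 y1 y2 <- <-.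
exact: ReD.
Qed.

Lemma Re_realM (R : realType) (a : R) (z : R[i]) :
  complex.Re (a%:C%C * z) = a * complex.Re z.
Proof. by case: z => x y /=; rewrite mul0r subr0. Qed.

Lemma Im_realM (R : realType) (a : R) (z : R[i]) :
  complex.Im (a%:C%C * z) = a * complex.Im z.
Proof. by case: z => x y /=; rewrite mul0r addr0. Qed.

Lemma ReV (R : realType) (z : R[i]) :
  complex.Re z^-1 = complex.Re z / cmod z ^+ 2.
Proof. by rewrite sqr_cmod; case: z. Qed.

Lemma cexpD (R : realType) (x y : R[i]) : cexp (x + y) = cexp x * cexp y.
Proof.
case: x y => [a b] [c d]; rewrite /cexp /= expRD cosD sinD.
by rewrite -[(_ +i* _)%C * (_ +i* _)%C]/(_ +i* _)%C; congr (_ +i* _)%C; ring.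
Qed.

Lemma cexp0 (R : realType) : cexp (0 : R[i]) = 1.
Proof. by rewrite /cexp /= expR0 cos0 sin0 mulr1 mulr0. Qed.

Lemma cmod_cexp (R : realType) (z : R[i]) :
  cmod (cexp z) = expR (complex.Re z).
Proof.
rewrite cmodE /cexp /= !exprMn -mulrDr cos2Dsin2 mulr1 sqrtr_sqr.
by rewrite ger0_norm ?expR_ge0.
Qed.

Lemma cexpXn (R : realType) (z : R[i]) n : cexp z ^+ n = cexp (n%:R * z).
Proof.
elim: n => [|n IHn]; first by rewrite expr0 mul0r cexp0.
by rewrite exprS IHn -cexpD -natr1 mulrDl mul1r addrC.
Qed.

Lemma ler_abs_sin (R : realType) (b : R) : `|sin b| <= `|b|.
Proof.
have pos (x : R) : 0 <= x -> `|sin x| <= x.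
  move=> x0.
  have [|c _] := @MVT_segment R sin cos 0 x x0.
    by apply: continuous_subspaceT; exact: continuous_sin.
  rewrite sin0 !subr0 => ->; rewrite normrM (ger0_norm x0).
  by rewrite ler_piMl// cos_max.
have [b0|b0] := leP 0 b; first by rewrite (ger0_norm b0) pos.
by rewrite -normrN -sinN (ltr0_norm b0) pos// oppr_ge0 ltW.
Qed.

Lemma ler_abs_cosB1 (R : realType) (b : R) : `|cos b - 1| <= b ^+ 2.
Proof.
have -> : cos b - 1 = - (sin (b / 2) ^+ 2 *+ 2).
  have -> : cos b = cos ((b / 2) *+ 2) by congr cos; rewrite mulr2n; lra.
  by rewrite cos_mulr2n sin2cos2 mulrnBl opprB addrC; ring.
rewrite normrN normrMn normrX.
have : `|sin (b / 2)| ^+ 2 <= `|b / 2| ^+ 2.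
  by rewrite lerXn2r ?nnegrE// ler_abs_sin.
rewrite [X in _ <= X -> _]real_normK ?num_real// exprMn -mulr_natl.
have := sqr_ge0 b; lra.
Qed.

Lemma ler_abs_sinB (R : realType) (b : R) : `|sin b - b| <= `|b| ^+ 3.
Proof.
have pos (x : R) : 0 <= x -> `|sin x - x| <= x ^+ 3.
  move=> x0.
  have [|c] := @MVT_segment R sin cos 0 x x0.
    by apply: continuous_subspaceT; exact: continuous_sin.
  rewrite in_itv/= => /andP[c0 cx].
  rewrite sin0 !subr0 => ->.
  rewrite -[X in _ - X]mul1r -mulrBl normrM (ger0_norm x0) exprSr.
  rewrite ler_wpM2r// (le_trans (ler_abs_cosB1 _))// lerXn2r//.
have [b0|b0] := leP 0 b; first by rewrite (ger0_norm b0) pos.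
have -> : sin b - b = - (sin (- b) - - b) by rewrite sinN; ring.
by rewrite normrN (ltr0_norm b0) pos// oppr_ge0 ltW.
Qed.

Lemma expR_le_quad (R : realType) (a : R) : `|a| <= 2^-1 ->
  (expR a <= 2) /\ (`|expR a - 1 - a| <= 2 * a ^+ 2).
Proof.
rewrite ler_norml => /andP[a1 a2].
have h1 := expR_ge1Dx a; have h2 := expR_ge1Dx (- a).
have E : expR a * expR (- a) = 1 by rewrite -expRD subrr expR0.
have p := expR_gt0 a.
have h3 : expR a * (1 - a) <= 1 by rewrite -[leRHS]E ler_pM2l.
have h4 : expR a <= 2 by nra.
split=> //.
rewrite ger0_norm; last by lra.
suff : expR a <= 1 + a + 2 * a ^+ 2 by lra.
have q : 0 <= (1 - 2 * a) * a ^+ 2 by rewrite mulr_ge0 ?sqr_ge0//; lra.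
have q2 : 1 <= (1 + a + 2 * a ^+ 2) * (1 - a).
  have -> : (1 + a + 2 * a ^+ 2) * (1 - a) = 1 + (1 - 2 * a) * a ^+ 2 by ring.
  lra.
rewrite -(@ler_pM2r _ (1 - a)); last by lra.
lra.
Qed.

(** An error of second order in each of n factors is what makes (1 + f / n) ^ n
    converge to exp f uniformly; it also yields the complex derivative. *)
Lemma cexp_quad (R : realType) (h : R[i]) : cmod h <= 2^-1 ->
  cmod (cexp h - 1 - h) <= 4 * cmod h ^+ 2.
Proof.
move=> hh; rewrite sqr_cmod.
have hR := le_trans (ger_Re_cmod h) hh.
have hI := le_trans (ger_Im_cmod h) hh.
apply: le_trans (cmod_le_ReIm _) _.
rewrite !(ReD, ImD, ReN, ImN) /cexp /=.
move: (complex.Re h) (complex.Im h) hR hI => a b hR hI.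
have [E2 EQ] := expR_le_quad hR; have E0 := expR_ge0 a.
have hc := ler_abs_cosB1 b; have hs := ler_abs_sinB b.
set E := expR a in E2 EQ E0 *.
have r1 : `|E * cos b - 1 - a| <= 2 * a ^+ 2 + 2 * b ^+ 2.
  have -> : E * cos b - 1 - a = (E - 1 - a) + E * (cos b - 1) by ring.
  apply: le_trans (ler_normD _ _) _; rewrite lerD// normrM (ger0_norm E0).
  by apply: ler_pM.
have bb : b ^+ 2 = `|b| ^+ 2 by rewrite real_normK// num_real.
have aa : a ^+ 2 = `|a| ^+ 2 by rewrite real_normK// num_real.
have r2 : `|E * sin b - 0 - b| <= 2 * `|b| ^+ 3 + 2 * `|a| * `|b|.
  have -> : E * sin b - 0 - b = E * (sin b - b) + (E - 1) * b by ring.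
  apply: le_trans (ler_normD _ _) _; rewrite !normrM (ger0_norm E0).
  apply: lerD; first exact: ler_pM.
  rewrite ler_wpM2r//.
  have -> : E - 1 = (E - 1 - a) + a by ring.
  apply: le_trans (ler_normD _ _) _.
  move: EQ; rewrite aa; have := normr_ge0 a; nra.
have n0 := normr_ge0 a; have m0 := normr_ge0 b.
have : `|b| ^+ 3 <= 2^-1 * `|b| ^+ 2.
  by rewrite exprS ler_wpM2r// sqr_ge0.
have : 0 <= (`|a| - `|b|) ^+ 2 by rewrite sqr_ge0.
rewrite bb aa in r1 r2 *; nra.
Qed.

Lemma cmod_cexpB1 (R : realType) (h : R[i]) : cmod h <= 2^-1 ->
  cmod (cexp h - 1) <= 3 * cmod h.
Proof.
move=> hh; have := cexp_quad hh => q.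
have := le_cmodD (cexp h - 1 - h) h; rewrite subrK.
have := cmod_ge0 h; nra.
Qed.

(** * Uniform limits of polynomials on the disk *)

Lemma unit_disk0 (R : realType) : unit_disk (0 : R[i]).
Proof. by change (cmod (0 : R[i]) < 1); rewrite cmod0 ltr01. Qed.

(** Membership in the disk algebra, with the boundary values left out. *)
Definition poly_approximable (R : realType) (f : R[i] -> R[i]) : Prop :=
  forall e : R, 0 < e -> exists p : {poly R[i]},
    forall z, unit_disk z -> cmod (f z - p.[z]) <= e.

Lemma horner_bounded (R : realType) (p : {poly R[i]}) :
  exists2 B : R, 1 <= B & forall z, unit_disk z -> cmod p.[z] <= B.
Proof.
exists (1 + \sum_(i < size p) cmod p`_i) => [|z z1].
  by rewrite lerDl sumr_ge0// => i _; exact: cmod_ge0.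
rewrite horner_coef (le_trans (le_cmod_sum _ _ _))//.
rewrite (@le_trans _ _ (\sum_(i < size p) cmod p`_i))//; last by rewrite lerDr.
apply: ler_sum => i _; rewrite cmodM cmodX ler_piMr ?cmod_ge0//.
by rewrite exprn_ile1 ?cmod_ge0// ltW.
Qed.

Lemma approximable_bounded (R : realType) (f : R[i] -> R[i]) :
  poly_approximable f ->
  exists2 B : R, 1 <= B & forall z, unit_disk z -> cmod (f z) <= B.
Proof.
move=> /(_ 1 ltr01)[p fp]; have [B B1 pB] := horner_bounded p.
exists (1 + B) => [|z z1]; first by rewrite lerDl (le_trans _ B1).
have := le_cmodD (f z - p.[z]) p.[z]; rewrite subrK.
by have := fp z z1; have := pB z z1; lra.
Qed.

Lemma eq_approximable (R : realType) (f g : R[i] -> R[i]) :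
  (forall z, unit_disk z -> f z = g z) ->
  poly_approximable f -> poly_approximable g.
Proof.
move=> fg af e e0; have [p fp] := af e e0; exists p => z z1.
by rewrite -fg//; exact: fp.
Qed.

Lemma approximable_horner (R : realType) (p : {poly R[i]}) :
  poly_approximable (fun z => p.[z]).
Proof. by move=> e e0; exists p => z _; rewrite subrr cmod0 ltW. Qed.

Lemma approximable_cst (R : realType) (c : R[i]) :
  poly_approximable (fun=> c).
Proof.
by apply: eq_approximable (approximable_horner c%:P) => z _; rewrite hornerC.
Qed.

Lemma approximableD (R : realType) (f g : R[i] -> R[i]) :
  poly_approximable f -> poly_approximable g ->
  poly_approximable (fun z => f z + g z).
Proof.
move=> af ag e e0; have e2 : 0 < e / 2 by rewrite divr_gt0.
have [p fp] := af _ e2; have [q gq] := ag _ e2.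
exists (p + q) => z z1; rewrite hornerD opprD addrACA.
rewrite (le_trans (le_cmodD _ _))//.
by have := fp z z1; have := gq z z1; lra.
Qed.

Lemma approximableM (R : realType) (f g : R[i] -> R[i]) :
  poly_approximable f -> poly_approximable g ->
  poly_approximable (fun z => f z * g z).
Proof.
move=> af ag e e0; have [C C1 fC] := approximable_bounded af.
have C0 : 0 < C by rewrite (lt_le_trans ltr01).
have [q gq] := ag _ (divr_gt0 e0 (mulr_gt0 (ltr0Sn R 1) C0)).
have [B B1 qB] := horner_bounded q.
have B0 : 0 < B by rewrite (lt_le_trans ltr01).
have [p fp] := af _ (divr_gt0 e0 (mulr_gt0 (ltr0Sn R 1) B0)).
exists (p * q) => z z1; rewrite hornerM.
have -> : f z * g z - p.[z] * q.[z] =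
          f z * (g z - q.[z]) + (f z - p.[z]) * q.[z] by ring.
rewrite (le_trans (le_cmodD _ _))// !cmodM.
have h1 : cmod (f z) * cmod (g z - q.[z]) <= C * (e / (2 * C)).
  by rewrite ler_pM ?cmod_ge0 ?fC ?gq.
have h2 : cmod (f z - p.[z]) * cmod q.[z] <= e / (2 * B) * B.
  by rewrite ler_pM ?cmod_ge0 ?fp ?qB.
rewrite (le_trans (lerD h1 h2))// le_eqVlt; apply/orP; left; apply/eqP.
by field; rewrite !gt_eqF.
Qed.

Lemma approximable_sum (R : realType) (I : Type) (s : seq I) (P : pred I)
    (F : I -> R[i] -> R[i]) :
  (forall i, P i -> poly_approximable (F i)) ->
  poly_approximable (fun z => \sum_(i <- s | P i) F i z).
Proof.
move=> aF; elim: s => [|i s IHs].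
  by apply: eq_approximable (approximable_cst 0) => z _; rewrite big_nil.
have [Pi|Pi] := boolP (P i).
  apply: eq_approximable (approximableD (aF i Pi) IHs) => z _.
  by rewrite big_cons Pi.
by apply: eq_approximable IHs => z _; rewrite big_cons (negPf Pi).
Qed.

Lemma exists_expr_le (R : realType) (b e : R) : 0 <= b < 1 -> 0 < e ->
  exists n : nat, b ^+ n <= e.
Proof.
move=> /andP[b0 b1] e0.
have b1' : `|b| < 1 by rewrite ger0_norm.
have := cvg_expr b1' => /cvgrPdist_le/(_ e e0)[n _ /(_ n (leqnn n))].
rewrite sub0r normrN ger0_norm ?exprn_ge0// => h; by exists n.
Qed.

Lemma subr_neq0_disk (R : realType) (b z : R[i]) : cmod b <= 1 ->
  unit_disk z -> 1 - b * z != 0.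
Proof.
move=> b1 z1; rewrite -cmod_gt0.
have := ler_cmodB 1 (b * z); rewrite cmod1 cmodM.
have : cmod b * cmod z <= cmod z by rewrite ler_piMl ?cmod_ge0.
move: z1; rewrite /unit_disk /=; lra.
Qed.

Lemma approximable_geometric (R : realType) (b : R[i]) : cmod b < 1 ->
  poly_approximable (fun z => (1 - b * z)^-1).
Proof.
move=> b1 e e0; have b0 := cmod_ge0 b.
have c0 : 0 < 1 - cmod b by rewrite subr_gt0.
have [n bn] := @exists_expr_le R (cmod b) (e * (1 - cmod b)) ltac:(by rewrite b0)
  (mulr_gt0 e0 c0).
exists (\sum_(i < n) (b *: 'X) ^+ i) => z z1.
have D0 := subr_neq0_disk (ltW b1) z1.
have -> : (1 - b * z)^-1 - (\sum_(i < n) (b *: 'X) ^+ i).[z] =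
          (b * z) ^+ n / (1 - b * z).
  have -> : (\sum_(i < n) (b *: 'X) ^+ i).[z] = \sum_(i < n) (b * z) ^+ i.
    by rewrite horner_sum; apply: eq_bigr => i _; rewrite horner_exp hornerZ hornerX.
  have := subrX1 (b * z) n => E.
  apply: (mulfI D0); rewrite mulrBr mulfV//.
  have -> : (1 - b * z) * (\sum_(i < n) (b * z) ^+ i) = 1 - (b * z) ^+ n.
    by rewrite -opprB mulNr -E opprB.
  by rewrite mulrCA mulfV// mulr1 opprB addrCA subrr addr0.
rewrite cmodM cmodV cmodX cmodM ler_pdivrMr ?cmod_gt0//.
have zle : cmod z <= 1 by exact: ltW.
have h1 : (cmod b * cmod z) ^+ n <= cmod b ^+ n.
  by rewrite lerXn2r ?nnegrE ?mulr_ge0 ?cmod_ge0// ler_piMr.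
rewrite (le_trans h1)// (le_trans bn)// ler_pM2l//.
have := ler_cmodB 1 (b * z); rewrite cmod1 cmodM.
have : cmod b * cmod z <= cmod b by rewrite ler_piMr.
lra.
Qed.

Lemma cmod_le_exp (R : realType) (x : R[i]) : cmod (1 + x) <= expR (cmod x).
Proof.
apply: le_trans (le_cmodD _ _) _; rewrite cmod1; exact: expR_ge1Dx.
Qed.

Lemma le_cmod_subX (R : realType) (a b : R[i]) (M : R) n :
  cmod a <= M -> cmod b <= M ->
  cmod (a ^+ n - b ^+ n) <= n%:R * M ^+ n.-1 * cmod (a - b).
Proof.
move=> aM bM; rewrite subrXX cmodM mulrC ler_wpM2r ?cmod_ge0//.
rewrite (le_trans (le_cmod_sum _ _ _))//.
have M0 : 0 <= M by rewrite (le_trans (cmod_ge0 a)).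
rewrite mulr_natl -[X in _ *+ X](card_ord n) -sumr_const.
apply: ler_sum => i _; rewrite cmodM !cmodX.
have -> : M ^+ n.-1 = M ^+ (n.-1 - i) * M ^+ i.
  by rewrite -exprD subnK// -ltnS prednK ?(leq_ltn_trans _ (ltn_ord i))//.
by rewrite ler_pM ?exprn_ge0 ?cmod_ge0// lerXn2r ?nnegrE ?cmod_ge0.
Qed.

(** The polynomials (1 + p / n) ^ n approximate exp f when p approximates f:
    n-th powers of nearby numbers of modulus at most 1 + O(1 / n) differ by
    O(n) times their distance, which is O(1 / n ^ 2) plus |f - p| / n. *)
Lemma approximable_cexp (R : realType) (f : R[i] -> R[i]) :
  poly_approximable f -> poly_approximable (fun z => cexp (f z)).
Proof.
move=> af e e0; have [B B1 fB] := approximable_bounded af.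
have B0 : 0 < B by rewrite (lt_le_trans ltr01).
set L := expR (B + 1).
have L0 : 0 < L by exact: expR_gt0.
have d0 : 0 < Num.min 1 (e / (2 * L)).
  by rewrite lt_min ltr01 divr_gt0// mulr_gt0.
have [p fp] := af _ d0.
pose n := (Num.trunc (2 * B + 8 * L * B ^+ 2 / e)).+1.
have nn0 : 0 < n%:R :> R by rewrite ltr0Sn.
have nlarge : 2 * B + 8 * L * B ^+ 2 / e < n%:R by exact: truncnS_gt.
have t0 : 0 <= 8 * L * B ^+ 2 / e.
  by rewrite divr_ge0 ?ltW// !mulr_gt0// exprn_gt0.
exists ((1 + n%:R^-1 *: p) ^+ n) => z z1.
rewrite horner_exp hornerD hornerZ hornerC.
have nC0 : n%:R != 0 :> R[i] by rewrite pnatr_eq0.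
have -> : cexp (f z) = cexp (n%:R^-1 * f z) ^+ n.
  by rewrite cexpXn mulrA mulfV// mul1r.
have fz := fB z z1; have := fp z z1; rewrite le_min => /andP[fp1 fpe].
have pz : cmod p.[z] <= B + 1.
  have := le_cmodD (p.[z] - f z) (f z); rewrite subrK cmodB; lra.
have h1 : cmod (cexp (n%:R^-1 * f z)) <= expR ((B + 1) / n%:R).
  rewrite cmod_cexp ler_expR (le_trans (ler_norm _))// (le_trans (ger_Re_cmod _))//.
  rewrite cmodM cmodV cmod_nat mulrC ler_pM2r ?invr_gt0//; lra.
have h2 : cmod (1 + n%:R^-1 * p.[z]) <= expR ((B + 1) / n%:R).
  rewrite (le_trans (cmod_le_exp _))// ler_expR.
  by rewrite cmodM cmodV cmod_nat mulrC ler_pM2r ?invr_gt0.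
rewrite (le_trans (le_cmod_subX _ h1 h2))//.
have hL : expR ((B + 1) / n%:R) ^+ n.-1 <= L.
  rewrite -expRM_natl ler_expR mulrCA ler_piMr ?addr_ge0// ?(ltW B0)//.
  by rewrite ler_pdivrMr// mul1r ler_nat leq_pred.
have hd : cmod (cexp (n%:R^-1 * f z) - (1 + n%:R^-1 * p.[z])) <=
    (4 * (B ^+ 2 / n%:R) + e / (2 * L)) / n%:R.
  have -> : cexp (n%:R^-1 * f z) - (1 + n%:R^-1 * p.[z]) =
     (cexp (n%:R^-1 * f z) - 1 - n%:R^-1 * f z) + n%:R^-1 * (f z - p.[z]).
    by ring.
  rewrite (le_trans (le_cmodD _ _))// mulrDl lerD//.
    have hs : cmod (n%:R^-1 * f z) <= B / n%:R.
      by rewrite cmodM cmodV cmod_nat mulrC ler_pM2r ?invr_gt0.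
    have hh : cmod (n%:R^-1 * f z) <= 2^-1.
      rewrite (le_trans hs)// ler_pdivrMr//; lra.
    rewrite (le_trans (cexp_quad hh))// -[leRHS]mulrA ler_pM2l//.
    rewrite (@le_trans _ _ ((B / n%:R) ^+ 2))//.
      by rewrite lerXn2r ?nnegrE ?cmod_ge0// divr_ge0// ltW.
    by rewrite exprMn exprVn -mulrA ler_pM2l ?exprn_gt0// -invfM expr2.
  by rewrite cmodM cmodV cmod_nat mulrC ler_pM2r ?invr_gt0.
have := ler_pM (mulr_ge0 (ltW nn0) (exprn_ge0 _ (expR_ge0 _))) (cmod_ge0 _)
  (ler_wpM2l (ltW nn0) hL) hd.
move=> /le_trans; apply.
have -> : n%:R * L * ((4 * (B ^+ 2 / n%:R) + e / (2 * L)) / n%:R) =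
   4 * L * B ^+ 2 / n%:R + e / 2.
  by field; rewrite !gt_eqF.
suff : 4 * L * B ^+ 2 / n%:R <= e / 2 by lra.
rewrite ler_pdivrMr//.
have : 8 * L * B ^+ 2 / e <= n%:R by lra.
rewrite ler_pdivrMr//; lra.
Qed.

(** The even part of p, read as a polynomial in the square of the variable,
    obeys the same bound on the squared circle because every point has a square
    root; halving the degree repeatedly leaves only the constant term. *)
Lemma horner0_circle (R : realType) (p : {poly R[i]}) (r B : R) :
  (forall z, cmod z = r -> cmod p.[z] <= B) -> 0 <= r -> cmod p.[0] <= B.
Proof.
have [k sk] : exists k, (size p <= 2 ^ k)%N.
  by exists (size p); rewrite ltnW// ltn_expl.
elim: k p r sk => [|k IHk] p r sk pB r0.
  have p0 : p.[0] = p.[r%:C%C] by rewrite (size1_polyC sk) !hornerC.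
  by rewrite p0 pB// cmod_real ger0_norm.
have -> : p.[0] = (even_poly p).[0].
  by rewrite !horner_coef0 coef_even_poly.
apply: (IHk _ (r ^+ 2)); last by rewrite exprn_ge0.
  rewrite (leq_trans (size_even_poly p))// leq_uphalf_double.
  by rewrite -mul2n -expnS.
move=> u ur; set z := sqrtc u.
have zu : z ^+ 2 = u by exact: sqr_sqrtc.
have zr : cmod z = r.
  apply/eqP; rewrite -(@eqrXn2 _ 2)// ?cmod_ge0//.
  by rewrite -cmodX zu ur.
have hE (w : R[i]) : p.[w] = (even_poly p).[w ^+ 2] + (odd_poly p).[w ^+ 2] * w.
  by rewrite -{1}(poly_even_odd p) hornerD hornerM !horner_comp !hornerE.
have e2 : (even_poly p).[u] = 2^-1 * (p.[z] + p.[- z]).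
  by rewrite !hE sqrrN zu; field.
rewrite e2 cmodM cmodV cmod_nat.
have h1 := pB _ zr; have h2 := pB (- z) ltac:(by rewrite cmodN).
have h3 := le_cmodD p.[z] p.[- z].
by rewrite mulrC ler_pdivrMr//; lra.
Qed.

(** The maximum principle at the centre passes from polynomials to their uniform
    limits, without recourse to Cauchy's theorem. *)
Lemma approximable_circle (R : realType) (f : R[i] -> R[i]) (r B : R) :
  poly_approximable f -> 0 <= r < 1 ->
  (forall z, cmod z = r -> cmod (f z) <= B) -> cmod (f 0) <= B.
Proof.
move=> af /andP[r0 r1] fB; apply/ler_addgt0Pr => e e0.
have [p fp] := af _ (divr_gt0 e0 (ltr0Sn R 1)).
have h0 := fp 0 (@unit_disk0 R).
have h1 : cmod p.[0] <= B + e / 2.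
  apply: (horner0_circle _ r0) => z zr.
  have zd : unit_disk z by rewrite /unit_disk /= zr.
  have := le_cmodD (p.[z] - f z) (f z); rewrite subrK cmodB.
  have := fp z zd; have := fB z zr; lra.
have := le_cmodD (f 0 - p.[0]) p.[0]; rewrite subrK; lra.
Qed.

(** * The integral condition as a dyadic series *)

Definition dyadic_itv (R : realType) (k : nat) : set R :=
  [set` `]2^-1 ^+ k, 2 * 2^-1 ^+ k]%R].

Lemma half_pow_gt0 (R : realType) k : 0 < (2^-1 : R) ^+ k.
Proof. by rewrite exprn_gt0// invr_gt0. Qed.

Lemma half_pow_le (R : realType) i j : (i <= j)%N ->
  (2^-1 : R) ^+ j <= 2^-1 ^+ i.
Proof. by move=> ij; rewrite ler_wiXn2l ?invr_ge0 ?invf_le1 ?ler1n. Qed.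

Lemma bigcup_dyadic_itv (R : realType) :
  \bigcup_k (@dyadic_itv R k) = [set` `]0, 2]%R].
Proof.
apply/seteqP; split => t /=.
  move=> [k _]; rewrite /dyadic_itv /= !in_itv/= => /andP[t1 t2].
  rewrite (lt_trans (half_pow_gt0 R k) t1)/= (le_trans t2)// ler_piMr//.
  exact: (half_pow_le R (leq0n k)).
rewrite in_itv/= => /andP[t0 t2].
have ex : exists k, (2^-1 : R) ^+ k < t.
  have [k hk] := @exists_expr_le R 2^-1 (t / 2) ltac:(lra) ltac:(lra).
  by exists k; lra.
case: (ex_minnP ex) => k kt kmin; exists k => //.
rewrite /dyadic_itv /= in_itv/= kt/=; case: k kt kmin => [|k] kt kmin.
  by rewrite expr0 mulr1.
rewrite exprS mulrA divff// mul1r leNgt; apply/negP => /kmin.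
by rewrite ltnn.
Qed.

Lemma trivIset_dyadic_itv (R : realType) :
  trivIset setT (@dyadic_itv R).
Proof.
have lt i j t : (i < j)%N -> @dyadic_itv R i t -> @dyadic_itv R j t -> False.
  move=> ij; rewrite /dyadic_itv /= !in_itv/= => /andP[i1 _] /andP[_ j2].
  have := half_pow_le R ij; rewrite exprS; lra.
apply/trivIsetP => i j _ _ ij; apply/seteqP; split => // t [ti tj].
by case: (ltngtP i j) ij => // h _; [exact: (lt _ _ _ h ti)|exact: (lt _ _ _ h tj)].
Qed.

(** Monotonicity is only known on the interval, and f may blow up at a, so that f
    need not extend to a monotone real function on the line. *)
Lemma measurable_noninc (R : realType) (f : R -> R) (a b : R) :
  (forall s t, a < s -> s <= t -> t <= b -> f t <= f s) ->
  measurable_fun [set` `]a, b]%R] f.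
Proof.
move=> fni mD; apply: (measurability (@RGenCInfty.G R)) mD => [|/= _ [_] [r] -> <-].
  exact: RGenCInfty.measurableE.
apply: is_interval_measurable => s t /=.
rewrite !in_itv/= !andbT => -[/andP[as_ sb] fs] [/andP[at_ tb] ft] u /andP[su ut].
have au := lt_le_trans as_ su; have ub := le_trans ut tb.
by split; rewrite /= in_itv/= ?andbT ?au// (le_trans ft)// fni.
Qed.

Lemma lebesgue_dyadic_itv (R : realType) k :
  (@lebesgue_measure R (@dyadic_itv R k) = (2^-1 ^+ k)%:E)%E.
Proof.
have p := half_pow_gt0 R k.
rewrite lebesgue_measure_itv/= lte_fin ifT; last by lra.
by rewrite -EFinB; congr EFin; lra.
Qed.

Lemma integral_dyadic (R : realType) (f : R -> R) :
  (forall s t, 0 < s -> s <= t -> t <= 2 -> f t <= f s) ->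
  (forall t, 0 < t -> t <= 2 -> 0 < f t) ->
  (\int[@lebesgue_measure R]_(t in `]0%R, 2%R]) (f t)%:E)%E =
  (\sum_(k <oo) \int[@lebesgue_measure R]_(t in @dyadic_itv R k) (f t)%:E)%E.
Proof.
move=> fni f0; rewrite -bigcup_dyadic_itv ge0_integral_bigcup//.
- by move=> k; exact: measurable_itv.
- rewrite bigcup_dyadic_itv; apply/measurable_EFinP; exact: measurable_noninc.
- move=> t; rewrite bigcup_dyadic_itv /= in_itv/= => /andP[t0 t2].
  by rewrite lee_fin ltW// f0.
- exact: trivIset_dyadic_itv.
Qed.

Lemma sub_dyadic_itv (R : realType) k t : @dyadic_itv R k t -> 0 < t <= 2.
Proof.
move=> kt; have : (\bigcup_k (@dyadic_itv R k)) t by exists k.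
by rewrite bigcup_dyadic_itv /= in_itv.
Qed.

Lemma integral_dyadic_le (R : realType) (f : R -> R) k :
  (forall s t, 0 < s -> s <= t -> t <= 2 -> f t <= f s) ->
  (forall t, 0 < t -> t <= 2 -> 0 < f t) ->
  (\int[@lebesgue_measure R]_(t in @dyadic_itv R k) (f t)%:E <=
   (f (2^-1 ^+ k) * 2^-1 ^+ k)%:E)%E.
Proof.
move=> fni f0; rewrite EFinM -lebesgue_dyadic_itv.
have mk : measurable (@dyadic_itv R k) by exact: measurable_itv.
rewrite -integral_cst//.
apply: ge0_le_integral => //.
- by move=> t /sub_dyadic_itv/andP[t0 t2]; rewrite lee_fin ltW// f0.
- apply/measurable_EFinP; apply: measurable_noninc => s t ks st tk.
  apply: fni => //; first exact: lt_trans (half_pow_gt0 R k) ks.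
  by rewrite (le_trans tk)// ler_piMr// (half_pow_le R (leq0n k)).
- move=> t tk; have /andP[t0 t2] := sub_dyadic_itv tk.
  move: tk; rewrite /dyadic_itv /= in_itv/= => /andP[t1 _].
  by rewrite lee_fin fni ?half_pow_gt0// ltW.
Qed.

Lemma integral_dyadic_ge (R : realType) (f : R -> R) k :
  (forall s t, 0 < s -> s <= t -> t <= 2 -> f t <= f s) ->
  (forall t, 0 < t -> t <= 2 -> 0 < f t) ->
  ((f (2 * 2^-1 ^+ k) * 2^-1 ^+ k)%:E <=
   \int[@lebesgue_measure R]_(t in @dyadic_itv R k) (f t)%:E)%E.
Proof.
move=> fni f0; rewrite EFinM -lebesgue_dyadic_itv.
have mk : measurable (@dyadic_itv R k) by exact: measurable_itv.
have k1 := half_pow_le R (leq0n k).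
rewrite -integral_cst//.
apply: ge0_le_integral => //.
- move=> t _; rewrite /cst lee_fin ltW// f0 ?mulr_gt0 ?half_pow_gt0//.
  by rewrite ler_piMr.
- apply/measurable_EFinP; apply: measurable_noninc => s t ks st tk.
  apply: fni => //; first exact: lt_trans (half_pow_gt0 R k) ks.
  by rewrite (le_trans tk)// ler_piMr.
- move=> t tk; have /andP[t0 t2] := sub_dyadic_itv tk.
  move: tk; rewrite /dyadic_itv /= in_itv/= => /andP[_ t1].
  by rewrite lee_fin fni// ler_piMr.
Qed.

(** Cauchy condensation: on ]2 ^ -k, 2 ^ (1 - k)], an interval of length 2 ^ -k,
    f lies between its values at the endpoints, and the two resulting series
    differ by a factor 2 and a shift. *)
Lemma integral_infty_dyadic (R : realType) (f : R -> R) :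
  (forall s t, 0 < s -> s <= t -> t <= 2 -> f t <= f s) ->
  (forall t, 0 < t -> t <= 2 -> 0 < f t) ->
  (\int[@lebesgue_measure R]_(t in `]0%R, 2%R]) (f t)%:E)%E = +oo%E <->
  forall S : R, exists n : nat,
    S < \sum_(0 <= k < n) f (2^-1 ^+ k) * 2^-1 ^+ k.
Proof.
move=> fni f0; rewrite integral_dyadic//.
have a0 k : 0 <= f (2^-1 ^+ k) * 2^-1 ^+ k.
  rewrite mulr_ge0 ?ltW ?f0 ?half_pow_gt0//.
  by rewrite (le_trans (half_pow_le R (leq0n k)))// ler1n.
have i0 k : (0 <= \int[@lebesgue_measure R]_(t in @dyadic_itv R k) (f t)%:E)%E.
  apply: integral_ge0 => t /sub_dyadic_itv/andP[t0 t2].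
  by rewrite lee_fin ltW// f0.
split=> [oo S|H].
- apply: contrapT => /forallNP Hn.
  have : (\sum_(k <oo) \int[@lebesgue_measure R]_(t in @dyadic_itv R k) (f t)%:E
          <= S%:E)%E.
    apply: lime_le; first exact: is_cvg_ereal_nneg_natsum.
    apply: nearW => n.
    apply: (@le_trans _ _ (\sum_(0 <= k < n) (f (2^-1 ^+ k) * 2^-1 ^+ k)%:E)%E).
      by apply: lee_sum => k _; exact: integral_dyadic_le.
    by rewrite sumEFin lee_fin leNgt; apply/negP/Hn.
  by rewrite oo leye_eq.
- apply/eqyP => S S0.
  have [n Sn] := H (2 * S + f 1).
  apply: (@le_trans _ _ (\sum_(0 <= k < n.+1) \int[@lebesgue_measure R]_(t in @dyadic_itv R k) (f t)%:E)%E); last first.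
    by apply: nneseries_lim_ge => k *; exact: i0.
  apply: (@le_trans _ _ (\sum_(0 <= k < n.+1) (f (2 * 2^-1 ^+ k) * 2^-1 ^+ k)%:E)%E); last first.
    by apply: lee_sum => k _; exact: integral_dyadic_ge.
  rewrite sumEFin lee_fin big_nat_recl//= expr0 !mulr1.
  have -> : \sum_(0 <= i < n) f (2 * 2^-1 ^+ i.+1) * 2^-1 ^+ i.+1 =
            2^-1 * \sum_(0 <= i < n) f (2^-1 ^+ i) * 2^-1 ^+ i.
    rewrite big_distrr/=; apply: eq_bigr => i _.
    by rewrite exprS mulrA divff// mul1r mulrCA.
  have := f0 2 (ltr0Sn R 1) (lexx _); have := f0 1 ltr01 (ler1n R 2).
  lra.
Qed.

(** * Reduction of cyclicity to the approximation of 1 *)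

Lemma norm_cmod (R : realType) (z : R[i]) : `|z| = (cmod z)%:C%C.
Proof. by case: z. Qed.

Lemma derivable_cexp (R : realType) (a : R[i]) :
  derivable (@cexp R : R[i]^o -> R[i]^o) a 1.
Proof.
apply/cvg_ex; exists (cexp a : R[i]^o).
apply/cvgrPdist_le => -[e e'] /=; rewrite ltcE/= => /andP[/eqP -> e0].
set d := Num.min (2^-1) (e / (4 * cmod (cexp a))).
have c0 : 0 < cmod (cexp a) by rewrite cmod_cexp expR_gt0.
have d0 : 0 < d by rewrite lt_min invr_gt0 ltr0Sn/= divr_gt0// mulr_gt0.
exists (d%:C%C); first by rewrite /= ltcR.
move=> h /=; rewrite sub0r normrN norm_cmod ltcR => hd h0.
rewrite norm_cmod lecR.
have -> : cexp a - h^-1 *: (cexp (h *: 1 + a) - cexp a) =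
  - (cexp a * (h^-1 * (cexp h - 1 - h))).
  rewrite -[h *: 1]/(h * 1) mulr1 cexpD -[_ *: _]/(h^-1 * _).
  by field.
rewrite cmodN !cmodM cmodV.
have hp : 0 < cmod h by rewrite cmod_gt0.
move: hd; rewrite lt_min => /andP[h2 he].
have q := cexp_quad (ltW h2).
move: he; rewrite ltr_pdivlMr ?mulr_gt0// => he.
have : cmod (cexp a) * ((cmod h)^-1 * cmod (cexp h - 1 - h)) <=
       cmod (cexp a) * ((cmod h)^-1 * (4 * cmod h ^+ 2)).
  by rewrite ler_wpM2l ?(ltW c0)// ler_wpM2l// invr_ge0 ltW.
move=> /le_trans; apply.
have -> : cmod (cexp a) * ((cmod h)^-1 * (4 * cmod h ^+ 2)) =
          cmod h * (4 * cmod (cexp a)) by field; rewrite gt_eqF.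
exact: ltW.
Qed.

Lemma disk_subr_neq0 (R : realType) (z : R[i]) : unit_disk z -> 1 - z != 0.
Proof.
by move=> z1; have := @subr_neq0_disk R 1 z; rewrite cmod1 mul1r; apply.
Qed.

Lemma analytic_inner_I (R : realType) : disk_analytic (@inner_I R).
Proof.
move=> z z1; have nz := disk_subr_neq0 z1.
apply/derivable1_diffP.
pose g : R[i]^o -> R[i]^o := fun w => - ((1 + w) * (1 - w)^-1).
have -> : (@inner_I R : R[i]^o -> R[i]^o) = (@cexp R : R[i]^o -> R[i]^o) \o g.
  by apply/funext.
apply: differentiable_comp; last exact/derivable1_diffP/derivable_cexp.
apply/derivable1_diffP; apply: derivableN; apply: derivableM.
  by apply: derivableD; [exact: derivable_cst|exact: derivable_id].
exact: derivableV.
Qed.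

(** This is 1 + (1 + z) / (1 - z).  The translation by 1 keeps the values at
    distance at least 1 from the imaginary axis, so that poles on that axis at
    unit spacing can stand for a continuous distribution. *)
Definition cayley (R : realType) (z : R[i]) : R[i] := 2 / (1 - z).

Lemma inner_I_cayley (R : realType) (z : R[i]) : unit_disk z ->
  inner_I z = cexp (1 - cayley z).
Proof.
move=> z1; have nz := disk_subr_neq0 z1; congr cexp; rewrite /cayley.
by field.
Qed.

(** Re v - 1 is the Poisson kernel at 1: small near every other boundary
    point. *)
Lemma Re_cayley (R : realType) (z : R[i]) : unit_disk z ->
  complex.Re (cayley z) - 1 = (1 - cmod z ^+ 2) / cmod (1 - z) ^+ 2.
Proof.
move=> z1; have nz := disk_subr_neq0 z1.
have s0 : 0 < cmod (1 - z) ^+ 2 by rewrite exprn_gt0 ?cmod_gt0.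
have -> : cayley z = 2%:C%C * (1 - z)^-1.
  by rewrite /cayley -(rmorph_nat (real_complex R)).
rewrite Re_realM ReV; apply: (mulIf (lt0r_neq0 s0)).
rewrite mulrBl mul1r mulrA !mulfVK ?gt_eqF// !sqr_cmod.
rewrite !(ReD, ReN, ImD, ImN) /=; ring.
Qed.

Lemma Re_cayley_ge1 (R : realType) (z : R[i]) : unit_disk z ->
  1 <= complex.Re (cayley z).
Proof.
move=> z1; rewrite -subr_ge0 Re_cayley// divr_ge0 ?sqr_ge0// subr_ge0.
by rewrite exprn_ile1 ?cmod_ge0// ltW.
Qed.

Lemma cmod_cayley (R : realType) (z : R[i]) :
  cmod (cayley z) = 2 / cmod (1 - z).
Proof. by rewrite /cayley cmodM cmodV cmod_nat. Qed.

Lemma dist1_disk (R : realType) (z : R[i]) : unit_disk z ->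
  0 < cmod (1 - z) /\ cmod (1 - z) <= 2.
Proof.
move=> z1; rewrite cmod_gt0 disk_subr_neq0//; split=> //.
have := le_cmodB 1 z; rewrite cmod1; move: z1; rewrite /unit_disk /=; lra.
Qed.

Lemma cmod_inner_I_le1 (R : realType) (z : R[i]) : unit_disk z ->
  cmod (inner_I z) <= 1.
Proof.
move=> z1; rewrite inner_I_cayley// cmod_cexp -expR0 ler_expR ReD ReN.
by have := Re_cayley_ge1 z1; rewrite /=; lra.
Qed.

Lemma in_closure_multiplesP (R : realType) (Lambda : R -> R)
    (f g : R[i] -> R[i]) :
  in_closure_multiples Lambda f g <->
  forall eps : R, 0 < eps -> exists p : {poly R[i]}, forall z, unit_disk z ->
    cmod (p.[z] * f z - g z) <= eps * expR (Lambda (cmod (1 - z))).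
Proof.
split=> H eps eps0.
  have [p /= pe] := H eps eps0; exists p => z z1.
  have : ((cmod (p.[z] * f z - g z) * expR (- Lambda (cmod (1 - z))))%:E <
          eps%:E)%E.
    by apply: le_lt_trans pe; apply: ereal_sup_ubound; exists z.
  by rewrite lte_fin expRN ltr_pdivrMr ?expR_gt0// => /ltW.
have [p pe] := H _ (divr_gt0 eps0 (ltr0Sn R 1)); exists p.
apply: (@le_lt_trans _ _ (eps / 2)%:E); last by rewrite lte_fin; lra.
apply: ge_ereal_sup => _ [z z1 <-].
by rewrite lee_fin expRN ler_pdivrMr ?expR_gt0//; exact: pe.
Qed.

Lemma weighted_space_bounded (R : realType) (Lambda : R -> R)
    (f : R[i] -> R[i]) (B : R) :
  (forall t : R, 0 < t -> t <= 2 -> 0 < Lambda t) -> disk_analytic f ->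
  (forall z, unit_disk z -> cmod (f z) <= B) -> weighted_space Lambda f.
Proof.
move=> L0 fan fB; split=> //.
apply: (@le_lt_trans _ _ B%:E); last exact: ltry.
apply: ge_ereal_sup => _ [z z1 <-]; rewrite lee_fin.
rewrite (le_trans _ (fB z z1))// ler_piMr ?cmod_ge0//.
have [s0 s2] := dist1_disk z1.
by rewrite -expR0 ler_expR oppr_le0 ltW// L0.
Qed.

Lemma weight_exponent_large (R : realType) (Lambda : R -> R) (A : R) :
  Lambda t @[t --> 0^'+] --> +oo ->
  exists2 d : R, 0 < d & forall t, 0 < t -> t <= d -> A <= Lambda t.
Proof.
move=> /cvgryPge/(_ A)[d /= d0 dA]; exists (d / 2); first exact: divr_gt0.
move=> t t0 td; apply: dA => //=.
by rewrite sub0r normrN gtr0_norm//; lra.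
Qed.

Lemma Re_subr_disk (R : realType) (z : R[i]) : unit_disk z ->
  0 < complex.Re (1 - z).
Proof.
move=> z1; rewrite ReD ReN /= subr_gt0.
exact: le_lt_trans (le_trans (ler_norm _) (ger_Re_cmod z)) z1.
Qed.

Lemma cmod_addr_real (R : realType) (w : R[i]) (c : R) : 0 <= c ->
  0 <= complex.Re w -> cmod w <= cmod (w + c%:C%C).
Proof.
move=> c0 w0; rewrite -(@ler_pXn2r _ 2)// ?nnegrE ?cmod_ge0// !sqr_cmod.
rewrite ReD ImD /= addr0 lerD2r lerXn2r ?nnegrE ?addr_ge0//; lra.
Qed.

(** The functions exp (1 - v'), with v' = 2 / (1 + c - z) and c > 0 small,
    extend analytically across the unit circle and tend to I uniformly away
    from 1; near 1 the weight makes any bounded difference small. *)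
Lemma inner_I_closure (R : realType) (Lambda : R -> R) :
  (forall t : R, 0 < t -> t <= 2 -> 0 < Lambda t) ->
  Lambda t @[t --> 0^'+] --> +oo ->
  polynomial_closure Lambda (@inner_I R).
Proof.
move=> Lpos L0; split.
  apply: (@weighted_space_bounded _ _ _ 1) => //; first exact: analytic_inner_I.
  exact: cmod_inner_I_le1.
apply/in_closure_multiplesP => eps eps0.
have e2 : 0 < eps / 2 by rewrite divr_gt0.
set E : R := expR 1.
have E0 : 0 < E by exact: expR_gt0.
have [d d0 dL] := weight_exponent_large (ln ((1 + E) / (eps / 2))) L0.
set m := Num.min 2^-1 (eps / (6 * E)).
have m0 : 0 < m by rewrite lt_min invr_gt0 ltr0Sn/= divr_gt0// mulr_gt0.
(* c makes the exponents differ by at most m where |1 - z| >= d *)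
pose c := m * d ^+ 2 / 2.
have c0 : 0 < c by rewrite divr_gt0// mulr_gt0// exprn_gt0.
pose b : R[i] := ((1 + c)^-1)%:C%C.
have c1 : 0 < 1 + c by lra.
have bb : cmod b < 1.
  by rewrite cmod_real ger0_norm ?invr_ge0 ?(ltW c1)// invf_lt1//; lra.
pose v' (z : R[i]) := 2 / (1 - z + c%:C%C).
have w0 z : unit_disk z -> 0 < complex.Re (1 - z + c%:C%C).
  by move=> /Re_subr_disk h; rewrite ReD /=; lra.
have wn0 z : unit_disk z -> 1 - z + c%:C%C != 0.
  move=> /w0; apply: contraTneq => ->; by rewrite ltxx.
have av : poly_approximable (fun z => cexp (1 - v' z)).
  apply: approximable_cexp; apply: approximableD; first exact: approximable_cst.
  apply: (@eq_approximable _ (fun z => (-2 * b) * (1 - b * z)^-1)).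
    move=> z z1; have h1 := wn0 z z1; have h2 := subr_neq0_disk (ltW bb) z1.
    rewrite /v'; have bE : b * (1 + c%:C%C) = 1.
      rewrite /b -(rmorph1 (real_complex R)) -rmorphD -rmorphM mulVf//.
      by rewrite gt_eqF.
    have bn0 : b != 0 by apply: contraTneq (oner_neq0 R[i]) => b0; rewrite -bE b0 mul0r eqxx.
    have -> : 1 - b * z = b * (1 - z + c%:C%C) by rewrite -{1}bE; ring.
    move: (1 - z + c%:C%C) (b) h1 bn0 => w b' h1 bn0.
    by field; rewrite bn0 h1.
  apply: approximableM; first exact: approximable_cst.
  exact: approximable_geometric.
have [p pe] := av _ e2; exists p => z z1.
have [s0 s2] := dist1_disk z1; set s := cmod (1 - z) in s0 s2 *.
have ex1 : 1 <= expR (Lambda s).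
  by rewrite -expR0 ler_expR ltW// Lpos.
rewrite mulr1.
apply: le_trans (le_cmod_dist (cexp (1 - v' z)) _ _) _.
have h1 : cmod (p.[z] - cexp (1 - v' z)) <= eps / 2 * expR (Lambda s).
  by rewrite cmodB (le_trans (pe z z1))// ler_peMr// ltW.
suff h2 : cmod (cexp (1 - v' z) - inner_I z) <= eps / 2 * expR (Lambda s).
  by lra.
have hE : cmod (cexp (1 - v' z)) <= E.
  rewrite cmod_cexp ler_expR ReD ReN /= lerBlDr lerDl.
  have -> : v' z = 2%:C%C * (1 - z + c%:C%C)^-1.
    by rewrite /v' -(rmorph_nat (real_complex R)).
  by rewrite Re_realM ReV mulr_ge0// divr_ge0 ?sqr_ge0// ltW// w0.
have [sd|ds] := leP s d.
  rewrite (le_trans (le_cmodB _ _))//.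
  have := cmod_inner_I_le1 z1.
  have := dL s s0 sd; rewrite -ler_expR lnK ?posrE ?divr_gt0 ?addr_gt0//.
  rewrite ler_pdivrMr//; lra.
have nz := disk_subr_neq0 z1; have wz := wn0 z z1.
have -> : cexp (1 - v' z) - inner_I z =
    - (cexp (1 - v' z) * (cexp (v' z - cayley z) - 1)).
  by rewrite mulrBr -cexpD inner_I_cayley// mulr1 opprB addrA subrK.
have hm : cmod (v' z - cayley z) <= m.
  have -> : v' z - cayley z = - (2 * c%:C%C / ((1 - z) * (1 - z + c%:C%C))).
    by rewrite /v' /cayley; field; rewrite wz nz.
  rewrite cmodN !cmodM cmodV cmodM cmod_nat cmod_real ger0_norm ?(ltW c0)//.
  have h := cmod_addr_real (ltW c0) (ltW (Re_subr_disk z1)); rewrite -/s in h *.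
  rewrite ler_pdivrMr; last by rewrite mulr_gt0 ?cmod_gt0.
  have -> : 2 * c = m * d ^+ 2 by rewrite /c; field.
  rewrite ler_pM2l//.
  rewrite expr2 ler_pM ?ltW//; exact: lt_le_trans h.
rewrite cmodN cmodM.
have m2 : m <= 2^-1 by rewrite /m ge_min lexx.
have hq := cmod_cexpB1 (le_trans hm m2).
have := ler_pM (cmod_ge0 _) (cmod_ge0 _) hE hq.
move=> /le_trans; apply.
have : m <= eps / (6 * E) by rewrite /m ge_min lexx orbT.
rewrite ler_pdivlMr ?mulr_gt0// => mE.
have : E * (3 * cmod (v' z - cayley z)) <= E * (3 * m).
  by rewrite ler_pM2l// ler_pM2l.
nra.
Qed.

(** A polynomial q close to g is bounded on the disk, so that q p f is close to q
    as soon as p f is close enough to 1. *)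
Lemma in_closure_trans (R : realType) (Lambda : R -> R) (f g : R[i] -> R[i]) :
  in_closure_multiples Lambda f (fun=> 1) ->
  in_closure_multiples Lambda (fun=> 1) g ->
  in_closure_multiples Lambda f g.
Proof.
move=> /in_closure_multiplesP fP /in_closure_multiplesP gP.
apply/in_closure_multiplesP => eps eps0.
have e2 : 0 < eps / 2 by rewrite divr_gt0.
have [q qe] := gP _ e2.
have [B B1 qB] := horner_bounded q.
have B0 : 0 < B by rewrite (lt_le_trans ltr01).
have [p pe] := fP _ (divr_gt0 e2 B0).
exists (q * p) => z z1; rewrite hornerM.
have -> : q.[z] * p.[z] * f z - g z =
   q.[z] * (p.[z] * f z - 1) + (q.[z] * 1 - g z) by ring.
rewrite (le_trans (le_cmodD _ _))// cmodM.
have h := ler_pM (cmod_ge0 _) (cmod_ge0 _) (qB z z1) (pe z z1).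
have BE : B * (eps / 2 / B * expR (Lambda (cmod (1 - z)))) =
          eps / 2 * expR (Lambda (cmod (1 - z))) by field; rewrite gt_eqF.
rewrite BE in h; have := qe z z1; lra.
Qed.

Lemma cyclic_inner_I (R : realType) (Lambda : R -> R) :
  (forall t : R, 0 < t -> t <= 2 -> 0 < Lambda t) ->
  Lambda t @[t --> 0^'+] --> +oo ->
  cyclic_in_weighted_space Lambda (@inner_I R) <->
  in_closure_multiples Lambda (@inner_I R) (fun=> 1).
Proof.
move=> Lpos L0; split=> [[_]|I1].
  apply; split.
    apply: (@weighted_space_bounded _ _ _ 1) => // z _.
    by rewrite cmod1.
  apply/in_closure_multiplesP => eps eps0; exists 1 => z z1.
  by rewrite hornerC mulr1 subrr cmod0 mulr_ge0 ?expR_ge0// ltW.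
split=> [|g [_ g1]]; first exact: inner_I_closure.
exact: in_closure_trans I1 g1.
Qed.

(** * Convergent integrals: a harmonic majorant of the weight *)

(** Powers of I make it possible to use the maximum principle at the centre only:
    I(0) ^ n is as small as desired, just as exp (- x) is far inside the
    half-plane. *)
Lemma in_closure_inner_I_exp (R : realType) (Lambda : R -> R) n :
  in_closure_multiples Lambda (@inner_I R) (fun=> 1) ->
  in_closure_multiples Lambda (fun z => inner_I z ^+ n) (fun=> 1).
Proof.
move=> /in_closure_multiplesP I1; apply/in_closure_multiplesP.
elim: n => [|n IHn] eps eps0.
  exists 1 => z z1.
  by rewrite hornerC expr0 mulr1 subrr cmod0 mulr_ge0 ?expR_ge0// ltW.
have e2 : 0 < eps / 2 by rewrite divr_gt0.
have [p pe] := I1 _ e2; have [B B1 pB] := horner_bounded p.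
have B0 : 0 < B by rewrite (lt_le_trans ltr01).
have [q qe] := IHn _ (divr_gt0 e2 B0).
exists (p * q) => z z1; rewrite hornerM.
have -> : p.[z] * q.[z] * inner_I z ^+ n.+1 - 1 =
   p.[z] * inner_I z * (q.[z] * inner_I z ^+ n - 1) + (p.[z] * inner_I z - 1).
  by rewrite exprS; ring.
rewrite (le_trans (le_cmodD _ _))// cmodM.
have pI : cmod (p.[z] * inner_I z) <= B.
  by rewrite cmodM -[leRHS]mulr1 ler_pM ?cmod_ge0 ?pB ?cmod_inner_I_le1.
have h := ler_pM (cmod_ge0 _) (cmod_ge0 _) pI (qe z z1).
have BE : B * (eps / 2 / B * expR (Lambda (cmod (1 - z)))) =
          eps / 2 * expR (Lambda (cmod (1 - z))) by field; rewrite gt_eqF.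
rewrite BE in h; have := pe z z1; lra.
Qed.

(** With v = 2 / (1 - z), this is 2 v / (v + rho), whose real part is positive
    on the right half-plane and at least 1 where |v| >= rho: a rational
    substitute for the harmonic measure of {|v| >= rho}. *)
Definition far_kernel (R : realType) (rho : R) (z : R[i]) : R[i] :=
  4 * (2 + rho%:C%C * (1 - z))^-1.

Lemma Re_far_kernel (R : realType) (rho : R) (z : R[i]) :
  complex.Re (far_kernel rho z) =
  4 * ((2 + rho * complex.Re (1 - z)) /
       (4 + 4 * rho * complex.Re (1 - z) + rho ^+ 2 * cmod (1 - z) ^+ 2)).
Proof.
rewrite /far_kernel -(rmorph_nat (real_complex R) 4) Re_realM ReV sqr_cmod.
rewrite [in RHS]sqr_cmod -(rmorph_nat (real_complex R) 2).
rewrite !(ReD, ImD, ReN, ImN, Re_realM, Im_realM) /=.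
by congr (4 * (_ / _)); ring.
Qed.

Lemma far_kernel_den_gt0 (R : realType) (rho : R) (z : R[i]) : 0 < rho ->
  unit_disk z ->
  0 < 4 + 4 * rho * complex.Re (1 - z) + rho ^+ 2 * cmod (1 - z) ^+ 2.
Proof.
move=> rho0 z1; have a0 := Re_subr_disk z1.
have h1 := mulr_gt0 rho0 a0.
have := mulr_ge0 (sqr_ge0 rho) (sqr_ge0 (cmod (1 - z))); lra.
Qed.

Lemma Re_far_kernel_ge0 (R : realType) (rho : R) (z : R[i]) : 0 < rho ->
  unit_disk z -> 0 <= complex.Re (far_kernel rho z).
Proof.
move=> rho0 z1; have d0 := far_kernel_den_gt0 rho0 z1.
rewrite Re_far_kernel mulr_ge0// divr_ge0 ?(ltW d0)//.
by rewrite addr_ge0// mulr_ge0 ?ltW// Re_subr_disk.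
Qed.

Lemma Re_far_kernel_ge1 (R : realType) (rho : R) (z : R[i]) : 0 < rho ->
  unit_disk z -> rho * cmod (1 - z) <= 2 ->
  1 <= complex.Re (far_kernel rho z).
Proof.
move=> rho0 z1 h; have d0 := far_kernel_den_gt0 rho0 z1.
rewrite Re_far_kernel mulrA ler_pdivlMr// mul1r.
have : (rho * cmod (1 - z)) ^+ 2 <= 2 ^+ 2.
  by rewrite lerXn2r ?nnegrE// mulr_ge0 ?cmod_ge0// ltW.
rewrite exprMn; lra.
Qed.

Lemma approximable_far_kernel (R : realType) (rho : R) : 0 < rho ->
  poly_approximable (far_kernel rho).
Proof.
move=> rho0; have r2 : 0 < 2 + rho by lra.
pose b : R[i] := (rho / (2 + rho))%:C%C.
have bb : cmod b < 1.
  rewrite cmod_real ger0_norm ?divr_ge0 ?ltW// ltr_pdivrMr//; lra.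
have dE : (2 + rho)%:C%C != 0 :> R[i].
  by rewrite -cmod_gt0 cmod_real normr_gt0 gt_eqF.
apply: (@eq_approximable _
  (fun z => 4 * ((2 + rho)%:C%C)^-1 * (1 - b * z)^-1)).
  move=> z z1; rewrite /far_kernel -mulrA -invfM; congr (_ * _^-1).
  rewrite mulrBr mulr1 mulrA /b -rmorphM mulrCA divff ?gt_eqF// mulr1.
  by rewrite rmorphD rmorph_nat; ring.
apply: approximableM; first exact: approximable_cst.
exact: approximable_geometric.
Qed.

Lemma far_kernel0 (R : realType) (rho : R) : 0 < rho ->
  complex.Re (far_kernel rho 0) <= 4 / rho.
Proof.
move=> rho0; rewrite Re_far_kernel subr0 cmod1 /= ler_pdivlMr//.
have -> : 4 + 4 * rho * 1 + rho ^+ 2 * 1 ^+ 2 = (2 + rho) ^+ 2 by ring.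
have r2 : 0 < 2 + rho by lra.
have -> : 4 * ((2 + rho * 1) / (2 + rho) ^+ 2) * rho = 4 * (rho / (2 + rho)).
  by field; rewrite gt_eqF.
by rewrite ler_piMr// ler_pdivrMr// mul1r; lra.
Qed.

(** Suppose p I ^ n close to 1.  Dividing p by the exponential of a combination
    of far kernels, one for each dyadic distance to 1 and with the value of
    Lambda there as coefficient, gives a function bounded by 2 e on a circle
    close to the unit circle, hence at 0; this bounds p at 0 independently of n,
    whereas I(0) ^ n tends to 0. *)
Lemma summable_not_in_closure (R : realType) (Lambda : R -> R) (S : R) :
  (forall s t : R, 0 < s -> s <= t -> t <= 2 -> Lambda t <= Lambda s) ->
  (forall t : R, 0 < t -> t <= 2 -> 0 < Lambda t) ->
  Lambda t @[t --> 0^'+] --> +oo ->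
  (forall n, \sum_(0 <= k < n) Lambda (2^-1 ^+ k) * 2^-1 ^+ k <= S) ->
  ~ in_closure_multiples Lambda (@inner_I R) (fun=> 1).
Proof.
move=> Lni Lpos L0 LS I1.
have lam0 k : 0 < Lambda (2^-1 ^+ k).
  apply: Lpos; first exact: half_pow_gt0.
  by rewrite (le_trans (half_pow_le R (leq0n k)))// ler1n.
(* exp n exceeds twice the bound 2 exp (1 + 4 S) for p at 0 *)
pose n := (Num.trunc (4 * expR (1 + 4 * S))).+1.
have nlarge : 4 * expR (1 + 4 * S) < n%:R by exact: truncnS_gt.
have /in_closure_multiplesP In := in_closure_inner_I_exp n I1.
have L1 : 0 < Lambda 1 by rewrite Lpos ?ler1n.
have [p pe] := In (expR (- Lambda 1) / 2) (divr_gt0 (expR_gt0 _) (ltr0Sn R 1)).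
have [B B1 pB] := horner_bounded p.
(* at distance less than 2 ^ -K from 1 the trivial bound for p is enough, so
   that finitely many kernels suffice *)
have [d d0 dL] := weight_exponent_large (ln B) L0.
have [K Kd] : exists K, (2^-1 : R) ^+ K <= d by apply: exists_expr_le => //; lra.
have BK : B <= expR (Lambda (2^-1 ^+ K)).
  rewrite -ler_ln ?posrE ?expR_gt0 ?(lt_le_trans ltr01)// expRK.
  by rewrite dL ?half_pow_gt0.
pose H z := \sum_(i < K.+1) (Lambda (2^-1 ^+ i))%:C%C * far_kernel (2 ^+ i) z.
pose F z := p.[z] * cexp (- H z).
have pow0 i : 0 < (2 : R) ^+ i by rewrite exprn_gt0.
have aF : poly_approximable F.
  apply: approximableM; first exact: approximable_horner.
  apply: approximable_cexp.
  apply: (@eq_approximable _ (fun z => -1 * H z)) => [z _|]; first by rewrite mulN1r.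
  apply: approximableM; first exact: approximable_cst.
  apply: approximable_sum => i _; apply: approximableM.
    exact: approximable_cst.
  exact: approximable_far_kernel.
have ReH z : complex.Re (H z) =
    \sum_(i < K.+1) Lambda (2^-1 ^+ i) * complex.Re (far_kernel (2 ^+ i) z).
  by rewrite Re_sum; apply: eq_bigr => i _; rewrite Re_realM.
have ReH_ge z (i : 'I_K.+1) : unit_disk z -> 2 ^+ i * cmod (1 - z) <= 2 ->
    Lambda (2^-1 ^+ i) <= complex.Re (H z).
  move=> z1 iz; rewrite ReH (bigD1 i)//= -[leLHS]addr0 lerD//.
    by rewrite ler_peMr ?Re_far_kernel_ge1// ltW.
  by rewrite sumr_ge0// => j _; rewrite mulr_ge0 ?Re_far_kernel_ge0// ltW.
have cF z : cmod (F z) = cmod p.[z] * expR (- complex.Re (H z)).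
  by rewrite /F cmodM cmod_cexp ReN.
(* the factor exp (n (Re v - 1)) stays below e on the circle of radius r *)
pose T : R := n%:R * 4 ^+ K * 2 + 1.
have nK0 : 0 <= n%:R * 4 ^+ K :> R by rewrite mulr_ge0 ?exprn_ge0.
have T1 : 1 <= T by rewrite /T; lra.
have T0 : 0 < T by rewrite (lt_le_trans ltr01).
have iT0 : 0 < T^-1 by rewrite invr_gt0.
have iT1 : T^-1 <= 1 by rewrite invf_le1.
pose r := 1 - T^-1.
have r01 : 0 <= r < 1 by rewrite /r; lra.
have rT : n%:R * ((1 - r ^+ 2) * 4 ^+ K) <= 1.
  have : (n%:R * 4 ^+ K * 2) * T^-1 <= 1.
    by rewrite ler_pdivrMr// mul1r /T; lra.
  have -> : 1 - r ^+ 2 = T^-1 * 2 - T^-1 ^+ 2 by rewrite /r; ring.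
  have := mulr_ge0 nK0 (sqr_ge0 T^-1).
  move: (4 ^+ K) => Q; nra.
(* on the circle, the kernel of the dyadic interval that contains |1 - z|
   dominates the weight *)
have circle z : cmod z = r -> cmod (F z) <= 2 * expR 1.
  move=> zr.
  have z1 : unit_disk z by rewrite /unit_disk /= zr; case/andP: r01.
  have [s0 s2] := dist1_disk z1; set s := cmod (1 - z) in s0 s2.
  have e1 : 1 <= expR 1 :> R by rewrite -[leLHS]expR0 ler_expR.
  rewrite cF expRN ler_pdivrMr ?expR_gt0//.
  have [sK|Ks] := leP s (2^-1 ^+ K).
    have sK2 : 2 ^+ K * s <= 2.
      rewrite (@le_trans _ _ 1)// ?ler1n// (@le_trans _ _ (2 ^+ K * 2^-1 ^+ K))//.
        by rewrite ler_pM2l.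
      by rewrite -exprMn divff ?expr1n.
    have := @ReH_ge z ord_max z1 sK2; rewrite /= -ler_expR => HK.
    rewrite (le_trans (pB z z1))// (le_trans BK)// (le_trans HK)//.
    by rewrite ler_peMl ?expR_ge0//; lra.
  have : [set` `]0, 2]%R] s by rewrite /= in_itv/= s0 s2.
  rewrite -bigcup_dyadic_itv => -[i _]; rewrite /dyadic_itv /= in_itv/= => /andP[is_ si].
  have iK : (i < K.+1)%N.
    rewrite ltnNge; apply/negP => Ki.
    have := half_pow_le R Ki; rewrite exprS; lra.
  have si2 : 2 ^+ i * s <= 2.
    rewrite (@le_trans _ _ (2 ^+ i * (2 * 2^-1 ^+ i)))//.
      by rewrite ler_pM2l.
    by rewrite mulrCA -exprMn divff ?expr1n ?mulr1.
  have := @ReH_ge z (Ordinal iK) z1 si2; rewrite /= -ler_expR => HK.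
  have Ls : expR (Lambda s) <= expR (Lambda (2^-1 ^+ i)).
    by rewrite ler_expR Lni ?half_pow_gt0// ltW.
  have := pe z z1; rewrite -/s => pez.
  have eL : expR (- Lambda 1) <= 1 by rewrite -[leRHS]expR0 ler_expR oppr_le0 ltW.
  have Ls1 : 1 <= expR (Lambda s) by rewrite -expR0 ler_expR ltW// Lpos.
  have pI : cmod p.[z] * cmod (inner_I z ^+ n) <= 2 * expR (Lambda s).
    rewrite -cmodM; have := le_cmodD (p.[z] * inner_I z ^+ n - 1) 1.
    rewrite subrK cmod1.
    have : expR (- Lambda 1) / 2 * expR (Lambda s) <= 1 / 2 * expR (Lambda s).
      by rewrite ler_wpM2r ?expR_ge0//; lra.
    lra.
  have In1 : expR (- 1) <= cmod (inner_I z ^+ n).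
    rewrite inner_I_cayley// cexpXn cmod_cexp ler_expR.
    rewrite -(rmorph_nat (real_complex R)) Re_realM ReD ReN /=.
    rewrite -opprB mulrN lerN2 Re_cayley// zr -/s.
    apply: le_trans rT; rewrite ler_wpM2l// ler_wpM2l//.
      by case/andP: r01 => r0 r1; rewrite subr_ge0 exprn_ile1// ltW.
    rewrite -[leRHS]invrK lef_pV2 ?posrE ?invr_gt0 ?exprn_gt0//.
    have -> : (4 ^+ K)^-1 = (2^-1 ^+ K) ^+ 2 :> R.
      by rewrite exprAC -exprVn; congr (_ ^+ _); field.
    by rewrite lerXn2r ?nnegrE ?cmod_ge0 ?exprn_ge0// ltW.
  have e0 := expR_gt0 (-1 : R).
  have eE : expR (-1) * expR 1 = 1 :> R by rewrite -expRD addNr expR0.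
  have : cmod p.[z] * expR (- 1) <= 2 * expR (complex.Re (H z)).
    have := ler_wpM2l (cmod_ge0 p.[z]) In1; lra.
  move=> /(ler_wpM2r (expR_ge0 1)); rewrite -mulrA eE mulr1; lra.
have F0 := approximable_circle aF r01 circle.
have H0 : complex.Re (H 0) <= 4 * S.
  rewrite ReH; apply: (@le_trans _ _
    (4 * \sum_(0 <= k < K.+1) Lambda (2^-1 ^+ k) * 2^-1 ^+ k)).
    rewrite big_mkord mulr_sumr; apply: ler_sum => i _.
    rewrite [leRHS]mulrCA ler_pM2l// (le_trans (far_kernel0 (pow0 i)))//.
    by rewrite exprVn.
  by rewrite ler_pM2l.
have p0 : cmod p.[0] <= 2 * expR (1 + 4 * S).
  move: F0; rewrite cF expRN ler_pdivrMr ?expR_gt0// => /le_trans; apply.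
  by rewrite -mulrA -expRD ler_pM2l// ler_expR lerD2l.
have := pe 0 (@unit_disk0 R); rewrite subr0 cmod1.
rewrite mulrAC -expRD addNr expR0 mul1r.
have I0 : cmod (inner_I 0 ^+ n) = expR (- n%:R) :> R.
  rewrite inner_I_cayley; last exact: unit_disk0.
  rewrite cexpXn cmod_cexp -(rmorph_nat (real_complex R)) Re_realM ReD ReN.
  have -> : cayley 0 = 2%:C%C :> R[i].
    by rewrite /cayley subr0 divr1 rmorph_nat.
  by congr expR; rewrite /=; lra.
have := ler_cmodB 1 (p.[0] * inner_I 0 ^+ n).
rewrite cmodB cmod1 cmodM I0 => h1 h2.
have en : 4 * expR (1 + 4 * S) < expR n%:R.
  by rewrite (lt_le_trans nlarge)// (le_trans _ (expR_ge1Dx _))// lerDr.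
have em : cmod p.[0] * expR (- n%:R) < 2^-1.
  rewrite expRN ltr_pdivrMr ?expR_gt0//; lra.
lra.
Qed.

(** * Sums of Poisson kernels over integer points *)

(** A telescoping majorant of the Poisson kernel at unit steps: s / (x + |s|) is
    increasing in s with values in [-1, 1]. *)
Lemma poisson_step (R : realType) (x s : R) : 1 <= x ->
  x / (x ^+ 2 + s ^+ 2) <=
  4 * ((s + 1) / (x + `|s + 1|) - s / (x + `|s|)).
Proof.
move=> x1.
have D0 : 0 < x ^+ 2 + s ^+ 2.
  by rewrite ltr_wpDr ?sqr_ge0// exprn_gt0//; lra.
have aux d : 0 < d -> d <= 4 * (x ^+ 2 + s ^+ 2) ->
    x <= 4 * (x / d) * (x ^+ 2 + s ^+ 2).
  move=> d0 h.
  have -> : 4 * (x / d) * (x ^+ 2 + s ^+ 2) = x * (4 * (x ^+ 2 + s ^+ 2) / d).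
    by ring.
  by rewrite ler_peMr ?ler_pdivlMr ?mul1r//; lra.
rewrite ler_pdivrMr//.
have [s0|s0] := leP 0 s.
  rewrite (ger0_norm s0) ger0_norm; last by lra.
  have -> : (s + 1) / (x + (s + 1)) - s / (x + s) =
            x / ((x + s) * (x + s + 1)).
    by field; apply/andP; split; rewrite gt_eqF//; lra.
  have d0 : 0 < (x + s) * (x + s + 1) by rewrite mulr_gt0//; lra.
  have : (x + s) * (x + s + 1) <= 4 * (x ^+ 2 + s ^+ 2).
    have := sqr_ge0 (x - s); nra.
  exact: aux.
have [s1|s1] := leP (s + 1) 0.
  rewrite (ltr0_norm s0) ler0_norm//.
  have -> : (s + 1) / (x - (s + 1)) - s / (x - s) =
            x / ((x - s) * (x - s - 1)).
    by field; apply/andP; split; rewrite gt_eqF//; lra.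
  have d0 : 0 < (x - s) * (x - s - 1) by rewrite mulr_gt0//; lra.
  have : (x - s) * (x - s - 1) <= 4 * (x ^+ 2 + s ^+ 2).
    have := sqr_ge0 (x + s); nra.
  exact: aux.
rewrite (ltr0_norm s0) gtr0_norm//.
have h1 : (s + 1) / (x + 1) <= (s + 1) / (x + (s + 1)).
  by rewrite ler_pM2l// lef_pV2 ?posrE; lra.
have h2 : - s / (x + 1) <= - s / (x - s).
  by rewrite ler_pM2l ?lef_pV2 ?posrE; lra.
have h3 : (s + 1) / (x + 1) + - s / (x + 1) = (x + 1)^-1.
  by rewrite -mulrDl addrAC subrr add0r mul1r.
have h4 : (2 * x)^-1 <= (x + 1)^-1 by rewrite lef_pV2 ?posrE; lra.
have h5 : (2 * x)^-1 * (2 * x) = 1 by rewrite mulVf// gt_eqF//; lra.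
rewrite mulNr in h2.
have h6 : (2 * x)^-1 <= (s + 1) / (x + (s + 1)) - s / (x - s).
  move: h2; rewrite mulNr; lra.
move: ((s + 1) / _ - _) h6 => Q h6.
have i0 : 0 < (2 * x)^-1 by rewrite invr_gt0; lra.
have : x <= 4 * (2 * x)^-1 * x ^+ 2 by nra.
have : 4 * (2 * x)^-1 * x ^+ 2 <= 4 * Q * x ^+ 2.
  by rewrite ler_wpM2r ?sqr_ge0// ler_pM2l.
have : 0 <= 4 * Q * s ^+ 2 by rewrite mulr_ge0 ?sqr_ge0//; lra.
lra.
Qed.

Lemma poisson_sum (R : realType) (x y : R) (a b : nat) : 1 <= x ->
  \sum_(a <= j < b) x / (x ^+ 2 + (y - j%:R) ^+ 2) <= 8.
Proof.
move=> x1; pose T (s : R) := s / (x + `|s|).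
have T1 s : `|T s| <= 1.
  have d0 : 0 < x + `|s| by rewrite ltr_wpDr//; lra.
  rewrite /T normrM normfV (gtr0_norm d0) ler_pdivrMr// mul1r; lra.
have [ab|/ltnW ba] := leqP a b; last by rewrite big_geq.
apply: (@le_trans _ _ (\sum_(a <= j < b) 4 * (T (j.+1%:R - y) - T (j%:R - y)))).
  apply: ler_sum => j _; rewrite -[(y - _) ^+ 2]sqrrN opprB.
  have -> : j.+1%:R - y = j%:R - y + 1 by rewrite -natr1 addrAC.
  exact: poisson_step.
rewrite -mulr_sumr (telescope_sumr (fun j => T (j%:R - y)) ab).
have := T1 (b%:R - y); have := T1 (a%:R - y).
rewrite !ler_norml => /andP[? ?] /andP[? ?]; lra.
Qed.

Definition poisson_pair (R : realType) (x y t : R) : R :=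
  x / (x ^+ 2 + (y - t) ^+ 2) + x / (x ^+ 2 + (y + t) ^+ 2).

Lemma poisson_pair_ge0 (R : realType) (x y t : R) : 0 <= x ->
  0 <= poisson_pair x y t.
Proof. by move=> x0; rewrite addr_ge0// divr_ge0// addr_ge0 ?sqr_ge0. Qed.

Lemma poisson_pair_sum (R : realType) (x y : R) (a b : nat) : 1 <= x ->
  \sum_(a <= j < b) poisson_pair x y j%:R <= 16.
Proof.
move=> x1; rewrite big_split/=; have h1 := poisson_sum y a b x1.
have h2 := poisson_sum (- y) a b x1.
rewrite (eq_bigr (fun j => x / (x ^+ 2 + (y + j%:R) ^+ 2))) in h2; last first.
  by move=> j _; rewrite -opprD sqrrN.
lra.
Qed.

(** Exactly 2 x (t ^ 2 + q) over a product that is at least (t ^ 2 - q) ^ 2, where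
    q = x ^ 2 + y ^ 2; the excess over 2 x / t ^ 2 keeps the factor x. *)
Lemma poisson_pair_far (R : realType) (x y t : R) : 0 < x -> 0 < t ->
  4 * (x ^+ 2 + y ^+ 2) <= t ^+ 2 ->
  poisson_pair x y t <=
  2 * x / t ^+ 2 + 10 * x * (x ^+ 2 + y ^+ 2) / (t ^+ 2) ^+ 2.
Proof.
move=> x0 t0 far.
have x2 : 0 < x ^+ 2 by rewrite exprn_gt0.
have t2 : 0 < t ^+ 2 by rewrite exprn_gt0.
have d1 : 0 < x ^+ 2 + (y - t) ^+ 2 by rewrite ltr_wpDr ?sqr_ge0.
have d2 : 0 < x ^+ 2 + (y + t) ^+ 2 by rewrite ltr_wpDr ?sqr_ge0.
set q := x ^+ 2 + y ^+ 2.
have q0 : 0 < q by rewrite ltr_wpDr ?sqr_ge0.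
have -> : poisson_pair x y t = 2 * x * (t ^+ 2 + q) /
    ((x ^+ 2 + (y - t) ^+ 2) * (x ^+ 2 + (y + t) ^+ 2)).
  rewrite /poisson_pair /q; field; by rewrite !gt_eqF.
have -> : 2 * x / t ^+ 2 + 10 * x * q / (t ^+ 2) ^+ 2 =
    2 * x * (t ^+ 2 + 5 * q) / (t ^+ 2) ^+ 2 by field; rewrite gt_eqF.
have DE : (x ^+ 2 + (y - t) ^+ 2) * (x ^+ 2 + (y + t) ^+ 2) =
    (t ^+ 2 - q) ^+ 2 + 4 * x ^+ 2 * t ^+ 2 by rewrite /q; ring.
have tq : 0 < t ^+ 2 - q by rewrite -/q in far; lra.
have D0 : 0 < (t ^+ 2 - q) ^+ 2 by rewrite exprn_gt0.
apply: (@le_trans _ _ (2 * x * (t ^+ 2 + q) / (t ^+ 2 - q) ^+ 2)).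
  have n0 : 0 < 2 * x * (t ^+ 2 + q) by rewrite !mulr_gt0// addr_gt0.
  rewrite ler_pM2l// lef_pV2 ?posrE ?mulr_gt0// DE.
  by rewrite lerDl ?mulr_ge0 ?ltW.
rewrite -!mulrA ler_pM2l// ler_pM2l// ler_pdivrMr// mulrAC ler_pdivlMr ?exprn_gt0//.
move: far; rewrite -/q; move: (t ^+ 2) t2 tq => u u0 uq far.
have : 0 <= q * ((u - 4 * q) * (2 * u - q) + q ^+ 2).
  by rewrite mulr_ge0 ?ltW// ltr_wpDl ?exprn_gt0// mulr_ge0; lra.
have -> : q * ((u - 4 * q) * (2 * u - q) + q ^+ 2) =
  (u + 5 * q) * (u - q) ^+ 2 - (u + q) * u ^+ 2 by ring.
lra.
Qed.

(** Its decrements dominate q / j ^ 3 in the range 4 q <= j ^ 2 of the far poles;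
    the cutoff makes it constant below that range, so that the decrements can be
    summed over all j. *)
Definition far_tail (R : realType) (q : R) (j : nat) : R :=
  Num.min (2 * q / j%:R ^+ 2) 2^-1.

Lemma far_tail_noninc (R : realType) (q : R) j : 0 <= q -> (0 < j)%N ->
  far_tail q j.+1 <= far_tail q j.
Proof.
move=> q0 j0; have jj : 0 < (j%:R : R) by rewrite ltr0n.
rewrite /far_tail le_min !ge_min lexx orbT andbT; apply/orP; left.
rewrite ler_wpM2l ?mulr_ge0// lef_pV2 ?posrE ?exprn_gt0 ?ltr0Sn//.
by rewrite lerXn2r ?nnegrE ?ler0n// ler_nat.
Qed.

Lemma far_tail_step (R : realType) (q : R) j : 0 <= q -> (0 < j)%N ->
  4 * q <= j%:R ^+ 2 ->
  q / j%:R ^+ 3 <= far_tail q j - far_tail q j.+1.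
Proof.
move=> q0 j0 far; have jj : 1 <= (j%:R : R) by rewrite ler1n.
have jp : 0 < (j%:R : R) by lra.
have -> : far_tail q j = 2 * q / j%:R ^+ 2.
  rewrite /far_tail; apply/min_idPl; rewrite ler_pdivrMr ?exprn_gt0//; lra.
apply: (@le_trans _ _ (2 * q / j%:R ^+ 2 - 2 * q / j.+1%:R ^+ 2)); last first.
  by rewrite lerD2l lerN2 /far_tail ge_min lexx.
rewrite -[j.+1%:R]natr1; move: (j%:R) jj jp => u u1 u0.
have -> : 2 * q / u ^+ 2 - 2 * q / (u + 1) ^+ 2 =
  q * (2 * (2 * u + 1) / (u ^+ 2 * (u + 1) ^+ 2)).
  by field; rewrite !gt_eqF//; lra.
have v0 : 0 < u + 1 by lra.
rewrite ler_wpM2l// ler_pdivlMr ?mulr_gt0 ?exprn_gt0//.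
rewrite mulrC ler_pdivrMr ?exprn_gt0//.
have -> : 2 * (2 * u + 1) * u ^+ 3 = u ^+ 2 * (4 * u ^+ 2 + 2 * u) by ring.
rewrite ler_pM2l ?exprn_gt0//; nra.
Qed.

(** The harmonic majorant estimate.  The poles within distance comparable to
    |v| contribute at most 16 G, by the telescoping bound; a pole further out
    contributes its linearization 2 m_j x / j ^ 2, up to an error that is
    proportional to x as well and small because m_j <= delta j. *)
Lemma poisson_sum_bound (R : realType) (x y delta G : R) (m : nat -> R)
    (a b : nat) : 1 <= x -> 0 <= delta -> 0 <= G -> (0 < a)%N ->
  (forall j, (a <= j < b)%N -> 0 <= m j <= delta * j%:R) ->
  (forall j, (a <= j < b)%N -> j%:R ^+ 2 < 4 * (x ^+ 2 + y ^+ 2) -> m j <= G) ->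
  \sum_(a <= j < b) m j * poisson_pair x y j%:R <=
  16 * G + x * (\sum_(a <= j < b) 2 * m j / j%:R ^+ 2 + 5 * delta).
Proof.
move=> x1 d0 G0 a0 mb mG; set q := x ^+ 2 + y ^+ 2.
have x0 : 0 < x by lra.
have q0 : 0 <= q by rewrite addr_ge0 ?sqr_ge0.
have pt j : (a <= j < b)%N -> m j * poisson_pair x y j%:R <=
    G * poisson_pair x y j%:R + x * (2 * m j / j%:R ^+ 2) +
    10 * delta * x * (far_tail q j - far_tail q j.+1).
  move=> ajb; have /andP[aj _] := ajb; have j0 := leq_trans a0 aj.
  have jp : 0 < (j%:R : R) by rewrite ltr0n.
  have /andP[m0 md] := mb j ajb.
  have P0 := poisson_pair_ge0 y j%:R (ltW x0).
  have t0 : 0 <= far_tail q j - far_tail q j.+1.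
    by rewrite subr_ge0 far_tail_noninc.
  have c0 : 0 <= 10 * delta * x by rewrite !mulr_ge0// ltW.
  have l0 : 0 <= x * (2 * m j / j%:R ^+ 2).
    by rewrite mulr_ge0 ?divr_ge0 ?mulr_ge0 ?sqr_ge0// ltW.
  have [far|near] := leP (4 * q) (j%:R ^+ 2).
    have h := ler_wpM2l m0 (poisson_pair_far x0 jp far).
    have ht := ler_wpM2l c0 (far_tail_step q0 j0 far).
    have GP := mulr_ge0 G0 P0.
    suff : m j * (10 * x * q / (j%:R ^+ 2) ^+ 2) <=
           10 * delta * x * (q / j%:R ^+ 3).
      have E : m j * (2 * x / j%:R ^+ 2 + 10 * x * q / (j%:R ^+ 2) ^+ 2) =
          x * (2 * m j / j%:R ^+ 2) + m j * (10 * x * q / (j%:R ^+ 2) ^+ 2).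
        by ring.
      rewrite -/q E in h; lra.
    have -> : 10 * delta * x * (q / j%:R ^+ 3) =
              delta * j%:R * (10 * x * q / (j%:R ^+ 2) ^+ 2).
      by field; rewrite gt_eqF.
    by rewrite ler_wpM2r// divr_ge0 ?sqr_ge0// !mulr_ge0// ltW.
  have := ler_wpM2r P0 (mG j ajb near).
  have := mulr_ge0 c0 t0; lra.
apply: (@le_trans _ _ (\sum_(a <= j < b)
  (G * poisson_pair x y j%:R + x * (2 * m j / j%:R ^+ 2) +
    10 * delta * x * (far_tail q j - far_tail q j.+1)))).
  by rewrite !big_nat; apply: ler_sum.
rewrite !big_split/= -!mulr_sumr.
have h1 := ler_wpM2l G0 (poisson_pair_sum y a b x1).
have h2 : \sum_(a <= j < b) (far_tail q j - far_tail q j.+1) <= 2^-1.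
  have [ab|/ltnW ba] := leqP a b; last by rewrite big_geq// invr_ge0.
  under eq_bigr do rewrite -opprB.
  rewrite sumrN (telescope_sumr (far_tail q) ab) opprB.
  have : 0 <= far_tail q b by rewrite le_min invr_ge0 ler0n divr_ge0 ?mulr_ge0 ?sqr_ge0.
  have : far_tail q a <= 2^-1 by rewrite ge_min lexx orbT.
  lra.
have c0 : 0 <= 10 * delta * x by rewrite !mulr_ge0// ltW.
have := ler_wpM2l c0 h2; lra.
Qed.

(** * Weights for the poles *)

(** Truncating the terms of a divergent series at a fixed level does not make it
    converge: if infinitely many terms are truncated, each of them contributes
    the level itself. *)
Lemma min_sum_unbounded (R : realType) (a : nat -> R) (delta : R) :
  0 < delta -> (forall k, 0 <= a k) ->
  (forall S, exists n, S < \sum_(0 <= k < n) a k) ->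
  forall k0 S, exists2 n, (k0 <= n)%N &
    S < \sum_(k0 <= k < n) Num.min delta (a k).
Proof.
move=> d0 a0 aoo k0 S.
have m0 k : 0 <= Num.min delta (a k) by rewrite le_min a0 ltW.
have [[k1 k1a]|often] := pselect (exists k1, forall k, (k1 <= k)%N -> a k <= delta).
  pose k2 := maxn k0 k1.
  have [n nS] := aoo (Num.max S 0 + \sum_(0 <= k < k2) a k).
  have SS : S <= Num.max S 0 by rewrite le_max lexx.
  have k2n : (k2 <= n)%N.
    rewrite leqNgt; apply/negP => /ltnW nk.
    have : \sum_(0 <= k < n) a k <= \sum_(0 <= k < k2) a k.
      by rewrite (big_cat_nat (leq0n n) nk)/= lerDl sumr_ge0.
    have : 0 <= Num.max S 0 by rewrite le_max lexx orbT.
    lra.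
  exists n; first exact: leq_trans (leq_maxl _ _) k2n.
  rewrite (big_cat_nat (leq_maxl k0 k1) k2n)/= ltr_wpDl ?sumr_ge0//.
  have {}nS : Num.max S 0 < \sum_(k2 <= k < n) a k.
    by move: nS; rewrite (big_cat_nat (leq0n k2) k2n)/=; lra.
  rewrite (le_lt_trans SS)// (lt_le_trans nS)// !big_nat ler_sum//.
  move=> k /andP[kk _].
  by rewrite le_min lexx andbT k1a// (leq_trans (leq_maxr _ _) kk).
have step p : exists2 n, (k0 <= n)%N &
    p%:R * delta <= \sum_(k0 <= k < n) Num.min delta (a k).
  elim: p => [|p [n kn IHn]]; first by exists k0 => //; rewrite mul0r big_geq.
  have [k nk ak] : exists2 k, (n <= k)%N & delta < a k.
    apply: contrapT => H; apply: often; exists n => k nk.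
    by rewrite leNgt; apply/negP => ak; apply: H; exists k.
  have kk := leq_trans kn nk.
  exists k.+1; first exact: leqW.
  rewrite big_nat_recr//= -natr1 mulrDl mul1r lerD//.
    by rewrite (le_trans IHn)// (big_cat_nat kn nk)/= lerDl sumr_ge0.
  by rewrite le_min lexx ltW.
have [n kn nS] := step (Num.trunc (S / delta)).+1.
exists n => //; apply: lt_le_trans nS.
by rewrite -ltr_pdivrMr//; exact: truncnS_gt.
Qed.

Lemma dyadic_sum_ge (R : realType) (F c : nat -> R) k0 k1 : (k0 <= k1)%N ->
  (forall k, (k0 <= k)%N -> c k <= \sum_(2 ^ k <= j < 2 ^ k.+1) F j) ->
  \sum_(k0 <= k < k1) c k <= \sum_(2 ^ k0 <= j < 2 ^ k1) F j.
Proof.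
move=> + H; elim: k1 => [|k1 IHk]; first by rewrite leqn0 => /eqP ->; rewrite !big_geq.
rewrite leq_eqVlt => /predU1P[->|]; first by rewrite !big_geq.
rewrite ltnS => kk; rewrite big_nat_recr//=.
rewrite [leRHS](@big_cat_nat _ _ _ (2 ^ k1))/= ?leq_exp2l//.
by rewrite lerD ?IHk ?H.
Qed.

(** On the block 2 ^ k <= j < 2 ^ (k + 1), the largest admissible weights give a
    sum of at least a quarter of the minimum of delta and a fixed multiple of
    Lambda(2 ^ (2 - k)) 2 ^ (2 - k), the dyadic term of index k - 2.  By
    divergence the blocks beyond any rank have unbounded sums, and scaling the
    weights down makes the sum equal to sigma. *)
Lemma pole_weights (R : realType) (Lambda : R -> R) (delta sigma A : R)
    (N0 : R) :
  (forall s t : R, 0 < s -> s <= t -> t <= 2 -> Lambda t <= Lambda s) ->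
  (forall t : R, 0 < t -> t <= 2 -> 0 < Lambda t) ->
  Lambda t @[t --> 0^'+] --> +oo ->
  (forall S : R, exists n : nat,
    S < \sum_(0 <= k < n) Lambda (2^-1 ^+ k) * 2^-1 ^+ k) ->
  0 < delta -> 0 <= sigma <= 1 ->
  exists (N N' : nat) (m : nat -> R),
    [/\ N0 <= N%:R, (2 <= N)%N,
        forall j, (N <= j < N')%N -> 0 <= m j <= delta * j%:R,
        forall j, (N <= j < N')%N -> m j <= (Lambda (4 / j%:R) - A) / 16 &
        \sum_(N <= j < N') 2 * m j / j%:R ^+ 2 = sigma].
Proof.
move=> Lni Lpos L0 Loo d0 /andP[sg0 sg1].
(* beyond N1, Lambda (4 / j) - A is at least Lambda (4 / j) / 2 *)
have [d dp dL] := weight_exponent_large (2 * `|A|) L0.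
pose N1 := Num.max N0 (4 / d).
pose k0 := (Num.trunc N1).+2.
have k0N : N1 <= (2 ^ k0)%:R.
  rewrite ltW// (lt_le_trans (truncnS_gt _))// ler_nat.
  by rewrite (leq_trans _ (ltnW (ltn_expl _ _))).
pose mu j := Num.min (delta * j%:R) ((Lambda (4 / j%:R) - A) / 16).
have jP j : (2 ^ k0 <= j)%N ->
    [/\ 0 < (j%:R : R), 0 < 4 / (j%:R : R), 4 / (j%:R : R) <= 2 &
        2 * `|A| <= Lambda (4 / j%:R)].
  move=> kj.
  have j2 : (2 <= j)%N.
    by rewrite (leq_trans _ kj)// -[X in (X <= _)%N]expn1 leq_exp2l.
  have jj : 0 < (j%:R : R) by rewrite ltr0n (leq_trans _ j2).
  split=> //; first by rewrite divr_gt0.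
    by rewrite ler_pdivrMr//; move: j2; rewrite -(ler_nat R); lra.
  apply: dL; first by rewrite divr_gt0.
  rewrite ler_pdivrMr// mulrC -ler_pdivrMr//.
  rewrite (@le_trans _ _ N1) ?le_max ?lexx ?orbT//.
  by rewrite (le_trans k0N)// ler_nat.
have LA j : (2 ^ k0 <= j)%N -> Lambda (4 / j%:R) / 2 <= Lambda (4 / j%:R) - A.
  move=> /jP[_ _ _ h]; have := ler_norm A; lra.
have mu0 j : (2 ^ k0 <= j)%N -> 0 <= mu j.
  move=> kj; have [jj t0 t2 _] := jP j kj.
  rewrite le_min; apply/andP; split; first by rewrite mulr_ge0// ltW.
  rewrite divr_ge0// (le_trans _ (LA j kj))// divr_ge0// ltW// Lpos//.
pose a k := Lambda (2^-1 ^+ k) * 2^-1 ^+ k.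
have a0 k : 0 <= a k.
  rewrite mulr_ge0 ?ltW ?Lpos ?half_pow_gt0//.
  by rewrite (le_trans (half_pow_le R (leq0n k)))// ler1n.
pose c k := Num.min (delta) (a (k - 2)%N / 128) / 4.
have block k : (k0 <= k)%N ->
    c k <= \sum_(2 ^ k <= j < 2 ^ k.+1) mu j / j%:R ^+ 2.
  move=> kk.
  have k2 : (2 <= k)%N by rewrite (leq_trans _ kk).
  have p0 : 0 < (2 ^ k)%:R :> R by rewrite ltr0n expn_gt0.
  set e := Num.min delta (a (k - 2)%N / 128).
  have e0 : 0 <= e by rewrite le_min ltW//= divr_ge0.
  have aE : a (k - 2)%N = Lambda (4 / (2 ^ k)%:R) * (4 / (2 ^ k)%:R).
    rewrite /a; have -> : (2^-1 : R) ^+ (k - 2) = 4 / (2 ^ k)%:R.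
      rewrite -{2}(subnK k2) expnD natrM !natrX exprVn invfM.
      by rewrite mulrCA divff ?mulr1// expf_neq0.
    by [].
  apply: (@le_trans _ _ (\sum_(2 ^ k <= j < 2 ^ k.+1) (e * (2 ^ k)%:R) / (2 * (2 ^ k)%:R) ^+ 2)).
    rewrite sumr_const_nat expnS mul2n -addnn addnK -[_ *+ _]mulr_natr /c -/e.
    rewrite le_eqVlt; apply/orP; left; apply/eqP.
    by move: ((2 ^ k)%:R) p0 => u u0; field; rewrite gt_eqF.
  rewrite !big_nat; apply: ler_sum => j /andP[kj jk].
  have kj0 : (2 ^ k0 <= j)%N by rewrite (leq_trans _ kj)// leq_exp2l.
  have [jj t0 t2 _] := jP j kj0.
  have pj : (2 ^ k)%:R <= j%:R :> R by rewrite ler_nat.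
  have jp : j%:R <= 2 * (2 ^ k)%:R :> R.
    by rewrite -natrM ler_nat -expnS ltnW.
  have hI : ((2 * (2 ^ k)%:R) ^+ 2)^-1 <= (j%:R ^+ 2)^-1 :> R.
    rewrite lef_pV2 ?posrE ?exprn_gt0 ?mulr_gt0//.
    by rewrite lerXn2r ?nnegrE ?mulr_ge0// ltW.
  apply: ler_pM hI; first by rewrite mulr_ge0// ltW.
    by rewrite invr_ge0 sqr_ge0.
  rewrite le_min; apply/andP; split.
    have ed : e <= delta by rewrite ge_min lexx.
    by apply: ler_pM => //; exact: ltW.
  apply: (@le_trans _ _ (Lambda (4 / (2 ^ k)%:R) / 32)).
    have : e <= a (k - 2)%N / 128 by rewrite ge_min lexx orbT.
    rewrite aE => /(ler_wpM2r (ltW p0)) /le_trans; apply.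
    by rewrite le_eqVlt; apply/orP; left; apply/eqP; field; rewrite gt_eqF.
  have := LA j kj0.
  have : Lambda (4 / (2 ^ k)%:R) <= Lambda (4 / j%:R).
    have [pp q0 q2 _] := jP (2 ^ k)%N ltac:(by rewrite leq_exp2l).
    by rewrite Lni// ler_pM2l// lef_pV2.
  lra.
have [k1 kk1 S1] : exists2 k1, (k0 <= k1)%N & 1 <= \sum_(k0 <= k < k1) c k.
  have a0' k : 0 <= a k / 128 by rewrite divr_ge0.
  have aoo' S : exists n, S < \sum_(0 <= k < n) a k / 128.
    have [n nS] := Loo (S * 128); exists n.
    by rewrite -mulr_suml ltr_pdivlMr.
  have [n kn nS] := min_sum_unbounded d0 a0' aoo' (k0 - 2) 4.
  exists n.+2; first by rewrite -add2n -leq_subLR.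
  have k02 : (2 <= k0)%N by [].
  rewrite -(subnK k02) big_addn /c -mulr_suml ler_pdivlMr// mul1r.
  rewrite (_ : (n.+2 - 2 = n)%N) ?subn2// ltW// (lt_le_trans nS)// le_eqVlt; apply/orP; left.
  by rewrite subn2; apply/eqP; apply: eq_bigr => i _; rewrite addnK.
set Sg := \sum_(2 ^ k0 <= j < 2 ^ k1) mu j / j%:R ^+ 2.
have Sg1 : 1 <= Sg by rewrite (le_trans S1)// dyadic_sum_ge.
have Sg0 : 0 < Sg by rewrite (lt_le_trans ltr01).
pose s := sigma / (2 * Sg).
have s0 : 0 <= s by rewrite divr_ge0 ?mulr_ge0// ltW.
have s1 : s <= 1 by rewrite ler_pdivrMr ?mulr_gt0//; lra.
exists (2 ^ k0)%N, (2 ^ k1)%N, (fun j => s * mu j).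
have msmall j : (2 ^ k0 <= j)%N -> s * mu j <= mu j.
  by move=> kj; rewrite ler_piMl// mu0.
split.
- by rewrite (le_trans _ k0N)// le_max lexx.
- by rewrite -[X in (X <= _)%N]expn1 leq_exp2l.
- move=> j /andP[kj _]; rewrite mulr_ge0 ?mu0//= (le_trans (msmall j kj))//.
  by rewrite ge_min lexx.
- move=> j /andP[kj _]; rewrite (le_trans (msmall j kj))//.
  by rewrite ge_min lexx orbT.
- rewrite (eq_bigr (fun j => (2 * s) * (mu j / j%:R ^+ 2))); last first.
    by move=> j _; ring.
  rewrite -mulr_sumr -/Sg /s; field; by rewrite gt_eqF.
Qed.

(** * Poisson kernels in the disk *)

(** With v = 2 / (1 - z), this is 2 v / (v ^ 2 + t ^ 2), whose real part is the
    sum of the Poisson kernels of the points i t and - i t of the boundary of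
    the half-plane. *)
Definition pole_kernel (R : realType) (t : R) (z : R[i]) : R[i] :=
  (cayley z - Complex 0 t)^-1 + (cayley z + Complex 0 t)^-1.

Lemma Re_pole_kernel (R : realType) (t : R) (z : R[i]) :
  complex.Re (pole_kernel t z) =
  poisson_pair (complex.Re (cayley z)) (complex.Im (cayley z)) t.
Proof.
rewrite /pole_kernel ReD !ReV !sqr_cmod !(ReD, ImD, ReN, ImN).
by move: (cayley z) => -[x y] /=; rewrite oppr0 !addr0.
Qed.

Lemma cayley_addi_neq0 (R : realType) (t : R) (z : R[i]) : unit_disk z ->
  cayley z + Complex 0 t != 0.
Proof.
move=> /Re_cayley_ge1; apply: contraTneq => /(congr1 (@complex.Re R)).
by rewrite ReD /= addr0 => ->; rewrite ler10.
Qed.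

(** The difference is 2 v ^ 3 / (t ^ 2 (v ^ 2 + t ^ 2)) up to sign. *)
Lemma pole_kernel_linear (R : realType) (t : R) (z : R[i]) : 0 < t ->
  unit_disk z -> 2 * cmod (cayley z) ^+ 2 <= t ^+ 2 ->
  cmod (pole_kernel t z - (2 / t ^+ 2)%:C%C * cayley z) <=
  2 / t ^+ 2 * (2 * cmod (cayley z) ^+ 3 / t ^+ 2).
Proof.
move=> t0 z1 h; set v := cayley z in h *; set w := Complex 0 t : R[i].
have t2 : 0 < t ^+ 2 by rewrite exprn_gt0.
have w2 : w ^+ 2 = - (t ^+ 2)%:C%C.
  rewrite expr2 /w -[(_ +i* _)%C * _]/(_ +i* _)%C !(mul0r, mulr0) addr0 sub0r.
  by rewrite -expr2 -rmorphN.
have vw1 : v + w != 0 by exact: cayley_addi_neq0.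
have vw2 : v - w != 0.
  have -> : - w = Complex 0 (- t) by rewrite /w -[LHS]/(_ +i* _)%C oppr0.
  exact: cayley_addi_neq0.
have cw2 : cmod (w ^+ 2) = t ^+ 2 by rewrite w2 cmodN cmod_real gtr0_norm.
have wn : w ^+ 2 != 0 by rewrite -cmod_gt0 cw2.
have -> : (2 / t ^+ 2)%:C%C = - (2 / w ^+ 2) :> R[i].
  by rewrite rmorphM rmorphV ?unitfE ?gt_eqF// rmorph_nat w2 invrN mulrN opprK.
have -> : pole_kernel t z - - (2 / w ^+ 2) * v =
    2 * v ^+ 3 / (w ^+ 2 * (v ^+ 2 - w ^+ 2)).
  rewrite /pole_kernel -/v -/w subr_sqr.
  have wn' : w != 0 by apply: contraNneq wn => ->; rewrite expr0n.
  by move: v w wn' vw1 vw2 {h w2 cw2 wn} => v w wn vw1 vw2; field; rewrite wn vw1 vw2.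
rewrite [cmod (_ / _)]cmodM cmodV [cmod (2 * _)]cmodM cmod_nat.
rewrite [cmod (w ^+ 2 * _)]cmodM cmodX cw2.
have d : t ^+ 2 / 2 <= cmod (v ^+ 2 - w ^+ 2).
  have := ler_cmodB (w ^+ 2) (v ^+ 2); rewrite cmodB cw2 cmodX; lra.
have d0 : 0 < cmod (v ^+ 2 - w ^+ 2) by rewrite (lt_le_trans _ d)// divr_gt0.
have v0 : 0 <= cmod v ^+ 3 by rewrite exprn_ge0 ?cmod_ge0.
rewrite ler_pdivrMr ?mulr_gt0//.
apply: (@le_trans _ _ (2 / t ^+ 2 * (2 * cmod v ^+ 3 / t ^+ 2) *
    (t ^+ 2 * (t ^+ 2 / 2)))).
  by rewrite le_eqVlt; apply/orP; left; apply/eqP; field; rewrite gt_eqF.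
rewrite ler_wpM2l ?ler_pM2l//.
have h1 : 0 <= 2 / t ^+ 2 by rewrite divr_ge0// ltW.
have h2 : 0 <= 2 * cmod v ^+ 3 / t ^+ 2.
  by rewrite divr_ge0//; [exact: mulr_ge0|exact: ltW].
exact: mulr_ge0.
Qed.

Lemma approximable_pole (R : realType) (t : R) :
  poly_approximable (fun z => (cayley z + Complex 0 t)^-1).
Proof.
pose c : R[i] := 2 + Complex 0 t.
have cE : c = Complex 2 t.
  rewrite /c -(rmorph_nat (real_complex R)).
  by rewrite -[LHS]/(_ +i* _)%C addr0 add0r.
have c0 : 0 < cmod c.
  by rewrite cE cmodE /= sqrtr_gt0 ltr_wpDr ?sqr_ge0// exprn_gt0.
have cn : c != 0 by rewrite -cmod_gt0.
pose b := Complex 0 t / c.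
have bb : cmod b < 1.
  rewrite cmodM cmodV ltr_pdivrMr// mul1r cE !cmodE /= ltr_sqrt.
    by rewrite expr0n/= add0r ltrDr exprn_gt0.
  by rewrite ltr_wpDr ?sqr_ge0// exprn_gt0.
apply: (@eq_approximable _ (fun z => (c^-1 * (1 - z)) * (1 - b * z)^-1)).
  move=> z z1; have nz := disk_subr_neq0 z1; have h := cayley_addi_neq0 t z1.
  have bz := subr_neq0_disk (ltW bb) z1.
  have -> : (cayley z + Complex 0 t) = c * (1 - b * z) / (1 - z).
    rewrite mulrBr mulr1 /b mulrA mulrCA divff// mulr1 /c /cayley.
    by move: (Complex 0 t) => w; field.
  by rewrite invfM invrK invfM mulrAC.
apply: approximableM; last exact: approximable_geometric.
apply: approximableM; first exact: approximable_cst.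
apply: (@eq_approximable _ (fun z => (1 - 'X : {poly R[i]}).[z])).
  by move=> z _; rewrite !hornerE.
exact: approximable_horner.
Qed.

Lemma approximable_pole_kernel (R : realType) (t : R) :
  poly_approximable (pole_kernel t).
Proof.
apply: approximableD; last exact: approximable_pole.
have := @approximable_pole R (- t); apply: eq_approximable => z _.
by congr (_ + _)^-1; rewrite -[RHS]/(_ +i* _)%C oppr0.
Qed.

(** * Divergent integrals: approximation of 1 *)

(** Near 1 the term 1 is negligible against exp Lambda, and exp (Re h - Re v) is
    at most exp (Lambda - A), by the harmonic majorant.  Elsewhere v is bounded
    and the poles are so far away that h is nearly (1 - 5 delta) v. *)
Lemma divergent_in_closure (R : realType) (Lambda : R -> R) :
  (forall s t : R, 0 < s -> s <= t -> t <= 2 -> Lambda t <= Lambda s) ->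
  (forall t : R, 0 < t -> t <= 2 -> 0 < Lambda t) ->
  Lambda t @[t --> 0^'+] --> +oo ->
  (forall S : R, exists n : nat,
    S < \sum_(0 <= k < n) Lambda (2^-1 ^+ k) * 2^-1 ^+ k) ->
  in_closure_multiples Lambda (@inner_I R) (fun=> 1).
Proof.
move=> Lni Lpos L0 Loo; apply/in_closure_multiplesP => eps' eps'0.
set eps := eps' / 2; have eps0 : 0 < eps by rewrite divr_gt0.
pose A := ln (16 / eps).
have eA : expR A = 16 / eps by rewrite lnK ?posrE ?divr_gt0.
have [d d0 dL] := weight_exponent_large A L0.
pose rho := 2 / d.
have rho0 : 0 < rho by rewrite divr_gt0.
pose eta := Num.min 2^-1 (eps / 3).
have eta0 : 0 < eta by rewrite lt_min invr_gt0 ltr0Sn/= divr_gt0.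
(* the two halves of eta pay for the linear term lost, 5 delta |v|, and for the
   linearization of the kernels, both on |v| <= rho *)
pose delta := Num.min 5^-1 (eta / (10 * rho)).
have delta0 : 0 < delta.
  by rewrite lt_min invr_gt0 ltr0Sn/= divr_gt0// mulr_gt0.
have delta5 : delta <= 5^-1 by rewrite ge_min lexx.
have deltar : 5 * delta * rho <= eta / 2.
  have : delta <= eta / (10 * rho) by rewrite ge_min lexx orbT.
  have r10 : 0 < 10 * rho by exact: mulr_gt0.
  rewrite ler_pdivlMr//; lra.
pose sigma := 1 - 5 * delta.
have sg : 0 <= sigma <= 1 by rewrite /sigma; lra.
have [N [N' [m [N0 N2 m0d mL msum]]]] := @pole_weights R Lambda delta sigma A
  (Num.max (2 * rho) (4 * rho ^+ 3 / eta)) Lni Lpos L0 Loo delta0 sg.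
pose h z := \sum_(N <= j < N') (m j)%:C%C * pole_kernel j%:R z.
have ah : poly_approximable (fun z => cexp (h z - 1)).
  apply: approximable_cexp; apply: approximableD; last exact: approximable_cst.
  apply: approximable_sum => j _; apply: approximableM.
    exact: approximable_cst.
  exact: approximable_pole_kernel.
have jN j : (N <= j)%N -> 2 <= j%:R :> R.
  by move=> Nj; rewrite (ler_nat R 2) (leq_trans N2).
have core z : unit_disk z ->
    cmod (cexp (h z - cayley z) - 1) <= eps * expR (Lambda (cmod (1 - z))).
  move=> z1; have [s0 s2] := dist1_disk z1; set s := cmod (1 - z) in s0 s2 *.
  set v := cayley z; have vs : cmod v = 2 / s by exact: cmod_cayley.
  have es1 : 1 <= expR (Lambda s) by rewrite -[leLHS]expR0 ler_expR ltW// Lpos.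
  have [sd|ds] := leP s d.
    pose G := (Lambda s - A) / 16.
    have G0 : 0 <= G by rewrite divr_ge0// subr_ge0 dL.
    have near j : (N <= j < N')%N ->
        j%:R ^+ 2 < 4 * (complex.Re v ^+ 2 + complex.Im v ^+ 2) -> m j <= G.
      move=> jNN; have /andP[Nj _] := jNN; rewrite -sqr_cmod => jv.
      have j2 := jN j Nj; have j0 : 0 < (j%:R : R) by exact: lt_le_trans j2.
      have js : j%:R < 4 / s.
        rewrite -(@ltr_pXn2r _ 2)// ?nnegrE ?divr_ge0 ?ltW//.
        rewrite (lt_le_trans jv)// vs le_eqVlt; apply/orP; left; apply/eqP.
        by field; rewrite gt_eqF.
      rewrite (le_trans (mL j jNN))//.
      rewrite ler_pM2r ?invr_gt0// lerD2r Lni//.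
        by rewrite ler_pdivlMr// mulrC -ler_pdivlMr// ltW.
      by rewrite ler_pdivrMr//; lra.
    have x1 := Re_cayley_ge1 z1.
    have N1 : (0 < N)%N by rewrite (leq_trans _ N2).
    have := poisson_sum_bound x1 (ltW delta0) G0 N1 m0d near.
    rewrite msum => hb.
    have Reh : complex.Re (h z) - complex.Re v <= 16 * G.
      rewrite /h Re_sum.
      under eq_bigr do rewrite Re_realM Re_pole_kernel.
      have : sigma + 5 * delta = 1 by rewrite /sigma; ring.
      move=> E; rewrite E mulr1 -/v in hb; lra.
    have : cmod (cexp (h z - v)) <= eps / 16 * expR (Lambda s).
      rewrite cmod_cexp ReD ReN; apply: (@le_trans _ _ (expR (16 * G))).
        by rewrite ler_expR.
      by rewrite /G mulrC divfK// expRD expRN eA invf_div mulrC.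
    have := le_cmodB (cexp (h z - v)) 1; rewrite cmod1.
    have := dL s s0 sd; rewrite -ler_expR eA ler_pdivrMr//.
    have := mulr_gt0 eps0 (expR_gt0 (Lambda s)); lra.
  have vr : cmod v <= rho.
    by rewrite vs ler_pM2l// lef_pV2 ?posrE// ltW.
  have N0r : 2 * rho <= N%:R by rewrite (le_trans _ N0)// le_max lexx.
  have N0e : 4 * rho ^+ 3 / eta <= N%:R.
    by rewrite (le_trans _ N0)// le_max lexx orbT.
  have lin j : (N <= j < N')%N ->
      cmod ((m j)%:C%C * pole_kernel j%:R z -
            (2 * m j / j%:R ^+ 2)%:C%C * v) <= 2 * m j / j%:R ^+ 2 * (eta / 2).
    move=> jNN; have /andP[Nj _] := jNN; have /andP[mj0 _] := m0d j jNN.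
    have j2 := jN j Nj; have j0 : 0 < (j%:R : R) by exact: lt_le_trans j2.
    have Njr : N%:R <= j%:R :> R by rewrite ler_nat.
    have c0 := cmod_ge0 v.
    have far : 2 * cmod v ^+ 2 <= j%:R ^+ 2.
      have : cmod v ^+ 2 <= rho ^+ 2 by rewrite lerXn2r ?nnegrE// ltW.
      have : (2 * rho) ^+ 2 <= j%:R ^+ 2.
        have r20 : 0 <= 2 * rho by rewrite mulr_ge0// ltW.
        by apply: lerXn2r; rewrite ?nnegrE ?ler0n// (le_trans N0r).
      by rewrite exprMn; have := sqr_ge0 rho; lra.
    have -> : (m j)%:C%C * pole_kernel j%:R z - (2 * m j / j%:R ^+ 2)%:C%C * v =
      (m j)%:C%C * (pole_kernel j%:R z - (2 / j%:R ^+ 2)%:C%C * v).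
      rewrite mulrBr; congr (_ - _); rewrite [RHS]mulrA -(rmorphM (real_complex R)).
      by congr (_%:C%C * _); ring.
    rewrite cmodM cmod_real ger0_norm//.
    have := ler_wpM2l mj0 (pole_kernel_linear j0 z1 far).
    move=> /le_trans; apply; rewrite mulrA.
    have -> : m j * (2 / j%:R ^+ 2) = 2 * m j / j%:R ^+ 2 by ring.
    rewrite ler_wpM2l ?divr_ge0 ?mulr_ge0 ?sqr_ge0//.
    rewrite ler_pdivrMr ?exprn_gt0//.
    have : cmod v ^+ 3 <= rho ^+ 3 by rewrite lerXn2r ?nnegrE// ltW.
    have : 4 * rho ^+ 3 <= j%:R * eta by rewrite -ler_pdivrMr//; lra.
    have : j%:R * eta <= j%:R ^+ 2 * eta by rewrite ler_pM2r// expr2; nra.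
    lra.
  have hv : cmod (h z - v) <= eta.
    have -> : h z - v = \sum_(N <= j < N') ((m j)%:C%C * pole_kernel j%:R z -
            (2 * m j / j%:R ^+ 2)%:C%C * v) - (5 * delta)%:C%C * v.
      rewrite sumrB -mulr_suml -rmorph_sum/= msum /sigma rmorphB rmorph1.
      by rewrite -/(h z); ring.
    apply: le_trans (le_cmodB _ _) _.
    have h1 : cmod ((5 * delta)%:C%C * v) <= eta / 2.
      rewrite cmodM cmod_real ger0_norm ?mulr_ge0 ?(ltW delta0)//.
      by rewrite (le_trans _ deltar)// ler_wpM2l// mulr_ge0// ltW.
    have h2 : cmod (\sum_(N <= j < N') ((m j)%:C%C * pole_kernel j%:R z -
            (2 * m j / j%:R ^+ 2)%:C%C * v)) <= sigma * (eta / 2).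
      rewrite (le_trans (le_cmod_sum _ _ _))// -msum mulr_suml !big_nat.
      exact: ler_sum.
    have : sigma * (eta / 2) <= eta / 2.
      by case/andP: sg => _ sg1; rewrite ler_piMl// divr_ge0// ltW.
    lra.
  have eta2 : eta <= 2^-1 by rewrite ge_min lexx.
  have eta3 : eta <= eps / 3 by rewrite ge_min lexx orbT.
  have := cmod_cexpB1 (le_trans hv eta2).
  have : eps <= eps * expR (Lambda s) by rewrite ler_peMr// ltW.
  lra.
have [p pe] := ah _ eps0; exists p => z z1.
set E := expR _.
have E1 : 1 <= E.
  have [s0 s2] := dist1_disk z1.
  by rewrite -[leLHS]expR0 ler_expR ltW// Lpos.
have -> : p.[z] * inner_I z - 1 = - ((cexp (h z - 1) - p.[z]) * inner_I z) +
    (cexp (h z - cayley z) - 1).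
  have hI : cexp (h z - 1) * inner_I z = cexp (h z - cayley z).
    by rewrite inner_I_cayley// -cexpD addrA subrK.
  by rewrite mulrBl hI; ring.
rewrite (le_trans (le_cmodD _ _))// cmodN cmodM.
have h1 : cmod (cexp (h z - 1) - p.[z]) * cmod (inner_I z) <= eps * 1.
  by rewrite ler_pM ?cmod_ge0 ?pe ?cmod_inner_I_le1.
have h2 := core z z1; rewrite -/E in h2.
have : eps <= eps * E by rewrite ler_peMr// ltW.
rewrite /eps in h1 h2 *; lra.
Qed.

Theorem theorem2 (R : realType) (Lambda : R -> R)
    (Lambda_noninc : forall s t : R, 0 < s -> s <= t -> t <= 2 ->
       Lambda t <= Lambda s)
    (Lambda_pos : forall t : R, 0 < t -> t <= 2 -> 0 < Lambda t)
    (Lambda_0 : Lambda t @[t --> 0^'+] --> +oo) :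
  cyclic_in_weighted_space Lambda (@inner_I R) <->
  (\int[@lebesgue_measure R]_(t in `]0%R, 2%R]) (Lambda t)%:E)%E = +oo%E.
Proof.
rewrite cyclic_inner_I// integral_infty_dyadic//; split=> [I1 S|].
  apply: contrapT => /forallNP H.
  apply: (summable_not_in_closure Lambda_noninc Lambda_pos Lambda_0 _ I1) => n.
  by rewrite leNgt; apply/negP/H.
exact: divergent_in_closure.
Qed.
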